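(* There is a deterministic polynomial-time algorithm which, given a finite field $\mathbb{F}_{p^s}=\mathbb{F}_p[\xi]/\langle\varphi\rangle$, elements $u,v,a_1,\dots,a_k\in\mathbb{F}_{p^s}$ and nonnegative integers $\alpha_j,\beta_j$ ($1\le j\le k$) with $p>\max_j(\alpha_j+\beta_j)$, decides whether \[P=\sum_{j=1}^k a_jX^{\alpha_j}(uX+v)^{\beta_j}\in\mathbb{F}_{p^s}[X]\] is identically zero.
   Context: The field $\mathbb{F}_{p^s}$ is given by the prime $p$ and a monic irreducible polynomial $\varphi\in\mathbb{F}_p[\xi]$ of degree $s$; its elements are represented by their representative polynomials of degree less than $s$. Exponents and $p$ are written in binary; the running time is polynomial in the total bit size of the input. *)

(* Defs.v *)
(* Deterministic single-tape Turing machines (a standard,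
   deeply embedded machine model) are defined below so that "there is a
   deterministic polynomial-time algorithm" can be stated faithfully. *)
From HB Require Import structures.
From mathcomp Require Import all_boot all_order all_algebra all_field.
Set Implicit Arguments.
Unset Strict Implicit.
Unset Printing Implicit Defensive.
Import GRing.Theory.
Local Open Scope ring_scope.

(* States are 'I_(Q+3): state 0 = start, 1 = accept, 2 = reject.       *)
(* Tape symbols are 'I_(S+3): 0 = blank, 1 = bit false, 2 = bit true.  *)
(* The tape is two-way infinite; accept/reject states are halting      *)
(* (absorbing).                                                        *)
Inductive move := MoveL | MoveR | Stay.

Record TM := {
  tm_Q : nat;
  tm_S : nat;
  tm_delta : 'I_tm_Q.+3 -> 'I_tm_S.+3 -> 'I_tm_Q.+3 * 'I_tm_S.+3 * move
}.

Section TMsem.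
Variable M : TM.
Local Notation St := 'I_(tm_Q M).+3.
Local Notation Sy := 'I_(tm_S M).+3.

(* configuration: state, left part of tape (nearest cell first),
   scanned symbol, right part of tape (nearest cell first) *)
Definition config := (St * seq Sy * Sy * seq Sy)%type.

Definition blank : Sy := ord0.
Definition sym_of_bit (b : bool) : Sy :=
  if b then @Ordinal (tm_S M).+3 2 isT else @Ordinal (tm_S M).+3 1 isT.

Definition halted (q : St) : bool := (nat_of_ord q == 1)%N || (nat_of_ord q == 2)%N.

Definition tm_step (c : config) : config :=
  let: (q, l, h, r) := c in
  if halted q then c else
  let: (q', w, m) := tm_delta q h in
  match m with
  | Stay => (q', l, w, r)
  | MoveL => match l with
             | [::] => (q', [::], blank, w :: r)
             | x :: l' => (q', l', x, w :: r)
             end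
  | MoveR => match r with
             | [::] => (q', w :: l, blank, [::])
             | x :: r' => (q', w :: l, x, r')
             end
  end.

Definition tm_init (w : seq bool) : config :=
  match w with
  | [::] => (ord0, [::], blank, [::])
  | b :: w' => (ord0, [::], sym_of_bit b, map sym_of_bit w')
  end.

Definition tm_run (t : nat) (w : seq bool) : config := iter t tm_step (tm_init w).

Definition tm_decides_within (w : seq bool) (b : bool) (t : nat) : Prop :=
  let: (q, _, _, _) := tm_run t w in
  nat_of_ord q = (if b then 1 else 2)%N.
End TMsem.

Fixpoint bits_aux (fuel n : nat) : seq bool :=
  match fuel with
  | 0 => [::]
  | fuel'.+1 => if n == 0%N then [::] else odd n :: bits_aux fuel' n./2
  end.
Definition bits (n : nat) : seq bool := bits_aux n n.

(* self-delimiting code of a natural number: each bit b becomes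
   [true; b], and the number is terminated by [false; false] *)
Definition enc_nat (n : nat) : seq bool :=
  flatten [seq [:: true; b] | b <- bits n] ++ [:: false; false].

Definition enc_nats (s : seq nat) : seq bool := flatten (map enc_nat s).

Definition GFq (p : nat) (phi : {poly 'F_p}) (hphi : monic_irreducible_poly phi) :=
  {poly %/ phi with hphi}.

(* an element of F_p[xi]/<phi> is given by its representative polynomial
   of degree < s = deg phi, i.e. by its s coefficients in F_p = {0..p-1} *)
Definition enc_coeffs (p s : nat) (q : {poly 'F_p}) : seq nat :=
  [seq nat_of_ord q`_i | i <- iota 0 s].

Definition field_elt_poly p (phi : {poly 'F_p}) (hphi : monic_irreducible_poly phi)
  (x : GFq hphi) : {poly 'F_p} := polyn x.

Definition enc_instance (p : nat) (phi : {poly 'F_p})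
    (hphi : monic_irreducible_poly phi) (u v : GFq hphi) (k : nat)
    (a : 'I_k -> GFq hphi) (alpha beta : 'I_k -> nat) : seq bool :=
  let s := (size phi).-1 in
  enc_nats ([:: p; s] ++ enc_coeffs s.+1 phi
            ++ enc_coeffs s (field_elt_poly u) ++ enc_coeffs s (field_elt_poly v)
            ++ [:: k]
            ++ flatten [seq enc_coeffs s (field_elt_poly (a j)) ++ [:: alpha j; beta j]
                       | j <- enum 'I_k]).

Definition sparse_shift_poly (F : comNzRingType) (u v : F) (k : nat)
    (a : 'I_k -> F) (alpha beta : 'I_k -> nat) : {poly F} :=
  \sum_(j < k) (a j)%:P * 'X^(alpha j) * (u *: 'X + v%:P) ^+ (beta j).

(* Main.v *)
(** Write [f_j = X^alpha_j (u X + v)^beta_j], let [D = X (u X + v) d/dX], so that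
    [D^i f_j = h_ij f_j] with [deg h_ij <= i], and let [rho] be neither [0] nor a
    root of [u X + v].  If [det (h_ij)] is nonzero, its adjugate expresses
    [det (h_ij) a_j f_j] through [P, D P, ..., D^(k-1) P], so a nonzero [P]
    vanishes at [rho] to order at most [deg det (h_ij) + k - 1 < k^2 + k].
    Otherwise the Wronskian of the [f_j] for [D] is zero; as their degrees are
    below [p], they are linearly dependent and one of them can be eliminated.
    One of [1], [2] is such a [rho] when [p > 2] and [(u, v) <> (0, 0)] (the other
    cases are easy), hence [P = 0] iff [P] vanishes modulo [(X - 1)^N] and
    [(X - 2)^N] for any [N >= k^2 + k + 2]; this is tested by repeated squaring in
    [F_q[T]/(T^N)].

    For the machine, functions are programs over four stacks of bits that act on
    codes of binary trees; such programs in polynomial time are closed under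
    pairing, composition, case analysis and size-bounded folds, and each stack
    becomes a track of the tape of a Turing machine. *)
Require Import Defs.
From HB Require Import structures.
From mathcomp Require Import all_boot all_order all_algebra all_field.
From mathcomp Require Import perm zify ring.
Set Implicit Arguments.
Unset Strict Implicit.
Unset Printing Implicit Defensive.
Import GRing.Theory.

(** * Stack programs on Turing machines *)

(** Exponents are binary, so [P] can have exponentially many coefficients; a multiplicity bound in
    [k] alone makes a few Taylor coefficients at one point sufficient. In characteristic [p] a
    vanishing Wronskian gives dependence only over the constants of the derivation, the rational
    functions in [X^p]; the bound on [alpha j + beta j] is what allows the descent to the field. The
    factor [X (u X + v)] of [D] clears the denominators of [f_j' / f_j = alpha_j / X + beta_j u / (u
    X + v)]. Both points are tested instead of choosing one: the zero polynomial passes every test,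
    and a nonzero [u X + v] cannot vanish at both. The machine takes [N = n^2 + 2] with [n] the
    number of integers in the input; [n > k] makes this large enough. On the machine side the
    obstacle is that iterating a polynomial-time step can blow up its accumulator. Hence every ring
    operation truncates its result to the width prescribed by the modulus, and the running time is
    polynomial on every word, even an ill-formed one. *)

Definition quad (T : Type) : Type := (T * T * T * T)%type.
Inductive reg := R0 | R1 | R2 | R3.

Definition get T (r : reg) (q : quad T) : T :=
  let: (a, b, c, d) := q in
  match r with R0 => a | R1 => b | R2 => c | R3 => d end.

Definition set T (r : reg) (v : T) (q : quad T) : quad T :=
  let: (a, b, c, d) := q in
  match r with
  | R0 => (v, b, c, d) | R1 => (a, v, c, d)
  | R2 => (a, b, v, d) | R3 => (a, b, c, v)
  end.

Definition qmap T U (f : T -> U) (q : quad T) : quad U :=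
  let: (a, b, c, d) := q in (f a, f b, f c, f d).

Lemma get_qmap T U (f : T -> U) r q : get r (qmap f q) = f (get r q).
Proof. by case: q => [[[a b] c] d]; case: r. Qed.

Lemma qmap_set T U (f : T -> U) r v q : qmap f (set r v q) = set r (f v) (qmap f q).
Proof. by case: q => [[[a b] c] d]; case: r. Qed.

Lemma set_get T r (q : quad T) : set r (get r q) q = q.
Proof. by case: q => [[[a b] c] d]; case: r. Qed.

Definition store := quad (seq bool).

Definition ssize (s : store) : nat :=
  let: (a, b, c, d) := s in size a + size b + size c + size d.

Lemma get_ssize r s : size (get r s) <= ssize s.
Proof. by case: s => [[[a b] c] d]; case: r => /=; lia. Qed.

Lemma ssize_set r x s : ssize (set r x s) + size (get r s) = ssize s + size x.
Proof. by case: s => [[[a b] c] d]; case: r => /=; lia. Qed.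

(** [Loop] pops a bit at each round, and its bodies may push onto the tested stack: that stack can
    thus serve as a counter of pending work or as a one-bit flag. *)
Inductive cmd :=
  | Skip
  | Push of reg & bool
  | Pop of reg & cmd & cmd & cmd
  | Seq of cmd & cmd
  | Loop of reg & cmd & cmd.

Inductive exec : cmd -> store -> nat -> store -> Prop :=
  | ESkip s : exec Skip s 1 s
  | EPush r b s : exec (Push r b) s 1 (set r (b :: get r s) s)
  | EPop0 r c0 c1 c2 s t s' : get r s = [::] -> exec c0 s t s' ->
      exec (Pop r c0 c1 c2) s t.+1 s'
  | EPop1 r c0 c1 c2 b x s t s' : get r s = b :: x ->
      exec (if b then c2 else c1) (set r x s) t s' ->
      exec (Pop r c0 c1 c2) s t.+1 s'
  | ESeq c1 c2 s s' s'' t t' : exec c1 s t s' -> exec c2 s' t' s'' ->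
      exec (Seq c1 c2) s (t + t') s''
  | ELoop0 r c1 c2 s : get r s = [::] -> exec (Loop r c1 c2) s 1 s
  | ELoop1 r c1 c2 b x s s' s'' t t' : get r s = b :: x ->
      exec (if b then c2 else c1) (set r x s) t s' ->
      exec (Loop r c1 c2) s' t' s'' ->
      exec (Loop r c1 c2) s (t + t').+1 s''.

(** A unit of time pushes at most one bit. This bounds both the head walks of the simulation and the
    output size of a program. *)
Lemma exec_ssize c s t s' : exec c s t s' -> ssize s' <= ssize s + t.
Proof.
elim=> {c s t s'} //.
- by move=> s; rewrite leq_addr.
- by move=> r b s; have := ssize_set r (b :: get r s) s; rewrite /=; lia.
- by move=> *; lia.
- move=> r c0 c1 c2 b x s t s' E _; have := ssize_set r x s; rewrite E /=; lia.
- by move=> *; lia.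
- by move=> *; lia.
- move=> r c1 c2 b x s s' s'' t t' E _; have := ssize_set r x s; rewrite E /=; lia.
Qed.

Inductive instr :=
  | IJmp of nat
  | IHalt of bool
  | IPush of reg & bool & nat
  | IPop of reg & nat & nat & nat.

Fixpoint clen (c : cmd) : nat :=
  match c with
  | Skip | Push _ _ => 1
  | Pop _ c0 c1 c2 => (clen c0 + clen c1 + clen c2).+1
  | Seq c1 c2 => clen c1 + clen c2
  | Loop _ c1 c2 => (clen c1 + clen c2).+1
  end.

(** Code placed at [pc] leaves by a jump to [nxt] on every path, so a branch or a loop body only
    needs a different exit address. *)
Fixpoint compile (c : cmd) (pc nxt : nat) : seq instr :=
  match c with
  | Skip => [:: IJmp nxt]
  | Push r b => [:: IPush r b nxt]
  | Pop r c0 c1 c2 =>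
      let p1 := pc.+1 + clen c0 in
      let p2 := p1 + clen c1 in
      IPop r pc.+1 p1 p2 ::
        compile c0 pc.+1 nxt ++ compile c1 p1 nxt ++ compile c2 p2 nxt
  | Seq c1 c2 =>
      compile c1 pc (pc + clen c1) ++ compile c2 (pc + clen c1) nxt
  | Loop r c1 c2 =>
      let p2 := pc.+1 + clen c1 in
      IPop r nxt pc.+1 p2 :: compile c1 pc.+1 pc ++ compile c2 p2 pc
  end.

Lemma size_compile c pc nxt : size (compile c pc nxt) = clen c.
Proof.
elim: c pc nxt => //= *; rewrite ?size_cat; repeat (match goal with
  | H : forall _ _, size _ = _ |- _ => rewrite H; clear H end); lia.
Qed.

(** * A four-track Turing machine that executes stack code *)

Section Machine.
Variable code : seq instr.
Let L := size code.

Definition cell : finType := (bool * quad (option bool))%type.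

(** The phases of an instruction: [Seek] walks right to the top of a stack, [Take] reads the bit to
    be popped, [Back] returns to the home cell. *)
Definition mstate : finType := ('I_L.+1 + 'I_L.+1 + 'I_L.+1)%type.

Definition Seek (n : nat) : mstate := inl (inl (inord n)).
Definition Take (n : nat) : mstate := inl (inr (inord n)).
Definition Back (n : nat) : mstate := inr (inord n).

Definition fetch (n : nat) : instr := nth (IHalt false) code n.

Definition cset (s : cell) r v : cell := (s.1, set r v s.2).

(* A pop seeks the first free cell of its track, one past the top. *)
Definition mdelta (q : mstate) (s : cell) : (mstate + bool) * cell * move :=
  match q with
  | inl (inl l) =>
      match fetch l with
      | IJmp n => (inl (Seek n), s, Stay)
      | IHalt b => (inr b, s, Stay)
      | IPush r b n =>
          if get r s.2 is None then (inl (Back n), cset s r (Some b), Stay)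
          else (inl q, s, MoveR)
      | IPop r n0 n1 n2 =>
          if get r s.2 is None then
            if s.1 then (inl (Seek n0), s, Stay) else (inl (Take l), s, MoveL)
          else (inl q, s, MoveR)
      end
  | inl (inr l) =>
      match fetch l with
      | IPop r n0 n1 n2 =>
          (inl (Back (if get r s.2 == Some true then n2 else n1)),
           cset s r None, Stay)
      | _ => (inr false, s, Stay)
      end
  | inr n => if s.1 then (inl (Seek n), s, Stay) else (inl q, s, MoveL)
  end.

Definition inj (T : finType) (x : T) : 'I_#|T|.+3 := @rshift 3 #|T| (enum_rank x).

Definition proj (T : finType) (n : 'I_#|T|.+3) : 'I_3 + T :=
  match @split 3 #|T| n with inl i => inl i | inr j => inr (enum_val j) end.

Lemma injK (T : finType) (x : T) : proj (inj x) = inr x.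
Proof.
rewrite /proj /inj -[rshift _ _]/(unsplit (inr (enum_rank x))) unsplitK.
by rewrite enum_rankK.
Qed.

Definition empty_cell : cell := (false, (None, None, None, None)).

(** The three reserved symbols are read as cells too: a blank is free on every track and an input
    bit lies on track [R0], so the input needs no translation pass. *)
Definition dec (h : 'I_#|cell|.+3) : cell :=
  match proj h with
  | inl i => cset empty_cell R0
      (if i == 0 :> nat then None else Some (i == 2 :> nat))
  | inr c => c
  end.

Lemma dec_inj c : dec (inj c) = c.
Proof. by rewrite /dec injK. Qed.

Definition encq (q : mstate + bool) : 'I_#|mstate|.+3 :=
  match q with
  | inl q => inj q
  | inr b => @lshift 3 #|mstate| (@Ordinal 3 (if b then 1 else 2) (if b is true as b return (if b then 1 else 2) < 3 then isT else isT))
  end.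

(** Of the reserved states only the start state is ever stepped from, since halting states are
    absorbing; that first step marks the scanned cell as home. *)
Definition delta (q : 'I_#|mstate|.+3) (h : 'I_#|cell|.+3) :=
  match proj q with
  | inl _ => (encq (inl (Seek 0)), inj (true, (dec h).2), Stay)
  | inr q => let: (q', s, m) := mdelta q (dec h) in (encq q', inj s, m)
  end.

Definition machine : TM := Build_TM delta.

(** The tape is viewed as an infinite word that begins at the home cell. The head never goes left of
    it, so the left part has exactly [pos] cells, and the blank default of [nth] covers the
    unvisited part. *)
Definition represents (c : config machine) (q : mstate + bool) pos (f : nat -> cell) :=
  let: (st, l, h, r) := c in
  [/\ st = encq q, size l = pos &
      forall i, dec (nth (blank machine) (rev l ++ h :: r) i) = f i].

Definition upd (f : nat -> cell) pos s := fun i => if i == pos then s else f i.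

Lemma dec_blank : dec (blank machine) = empty_cell.
Proof.
rewrite /dec /proj; case: splitP => /= j E; first by rewrite -E.
by move: E; lia.
Qed.

Lemma dec_bit b : dec (sym_of_bit machine b) = cset empty_cell R0 (Some b).
Proof.
rewrite /dec /proj; case: b; case: splitP => /= j E.
- by rewrite -E.
- by move: E; lia.
- by rewrite -E.
- by move: E; lia.
Qed.

Lemma halted_inl q : halted (encq (inl q) : 'I_(tm_Q machine).+3) = false.
Proof. by []. Qed.

Lemma represents_step c q pos f q' s m :
  represents c (inl q) pos f -> mdelta q (f pos) = (q', s, m) ->
  match m with
  | Stay => represents (tm_step c) q' pos (upd f pos s)
  | MoveR => represents (tm_step c) q' pos.+1 (upd f pos s)
  | MoveL => 0 < pos -> represents (tm_step c) q' pos.-1 (upd f pos s)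
  end.
Proof.
case: c => [[[st l] h] r] [-> sl tape] E.
have Eh : dec h = f pos by rewrite -tape nth_cat size_rev sl ltnn subnn.
have stepE : @tm_step machine (encq (inl q), l, h, r) =
    match m with
    | Stay => (encq q', l, inj s, r)
    | MoveL => match l with
               | [::] => (encq q', [::], blank machine, inj s :: r)
               | x :: l' => (encq q', l', x, inj s :: r)
               end
    | MoveR => match r with
               | [::] => (encq q', inj s :: l, blank machine, [::])
               | x :: r' => (encq q', inj s :: l, x, r')
               end
    end.
  rewrite /tm_step halted_inl /= /delta [proj _]injK Eh E /=.
  by case: m {E}.
have tape' i : dec (nth (blank machine) (rev l ++ inj s :: r) i) = upd f pos s i.
  rewrite /upd -tape !nth_cat size_rev sl; case: ltngtP => // [H|->].
    by case: (i - pos) (subn_gt0 pos i) => [|n]; rewrite ?H.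
  by rewrite subnn /= dec_inj.
rewrite stepE; case: m {E stepE} => [pos_gt0||].
- case: l sl tape' {tape} => [|x l] /= sl tape'; first by rewrite -sl in pos_gt0.
  split=> //; first by rewrite -sl.
  by move=> i; rewrite -tape' rev_cons cat_rcons.
- case: r tape' {tape} => [|x r] tape'; split => //=; rewrite ?sl // => i;
    rewrite -tape' rev_cons cat_rcons // !nth_cat size_rev.
  by case: ltngtP => // H; case: (i - size l) => [|[|n]] //=; rewrite nth_nil.
- by [].
Qed.

Lemma represents_ext c q pos f g :
  f =1 g -> represents c q pos f -> represents c q pos g.
Proof.
by move=> fg; case: c => [[[st l] h] r] [-> ? E]; split=> // i; rewrite E fg.
Qed.

Lemma upd_same f pos : upd f pos (f pos) =1 f.
Proof. by move=> i; rewrite /upd; case: eqP => // ->. Qed.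

Lemma walk_right q n c pos f :
  (forall i, pos <= i < pos + n -> mdelta q (f i) = (inl q, f i, MoveR)) ->
  represents c (inl q) pos f ->
  represents (iter n (@tm_step machine) c) (inl q) (pos + n) f.
Proof.
elim: n => [|n IH] H Rc; first by rewrite addn0.
rewrite addnS iterS; apply: (@represents_ext _ _ _ (upd f (pos + n) (f (pos + n)))).
  exact: upd_same.
have Rn : represents (iter n (@tm_step machine) c) (inl q) (pos + n) f.
  by apply: IH Rc => i Hi; apply: H; lia.
by apply: (represents_step Rn (H _ _)); lia.
Qed.

Lemma walk_left q n c f :
  (forall i, 0 < i <= n -> mdelta q (f i) = (inl q, f i, MoveL)) ->
  represents c (inl q) n f ->
  represents (iter n (@tm_step machine) c) (inl q) 0 f.
Proof.
elim: n c => [|n IH] c H Rc //.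
rewrite iterSr; apply: IH => [i Hi|]; first by apply: H; lia.
have := represents_step Rc (H n.+1 _) => /(_ ltac:(lia)) /(_ isT) /=.
exact/represents_ext/upd_same.
Qed.

(* Each stack grows to the right from the home cell, the only marked one. *)
Definition scell (s : store) (i : nat) : cell :=
  (i == 0, qmap (fun x => onth (rev x) i) s).

Definition at_home (c : config machine) (n : nat) (s : store) :=
  represents c (inl (Seek n)) 0 (scell s).

Lemma onth_lt T (x0 : T) s n : n < size s -> onth s n = Some (nth x0 s n).
Proof. by move=> ltn; rewrite onthE (nth_map x0). Qed.

Lemma onth_rev_lt (x : seq bool) i : i < size x -> exists b, onth (rev x) i = Some b.
Proof.
move=> lti; exists (nth false (rev x) i).
by rewrite (onth_lt false) ?size_rev.
Qed.

Lemma onth_rev_ge (x : seq bool) i : size x <= i -> onth (rev x) i = None.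
Proof. by move=> ?; rewrite onth_default ?size_rev. Qed.

Lemma onth_rev_cons (b : bool) x i :
  onth (rev (b :: x)) i = if i == size x then Some b else onth (rev x) i.
Proof.
rewrite rev_cons; case: ltngtP => [lti|gti|->].
- by rewrite !(onth_lt false) ?size_rcons ?size_rev ?nth_rcons ?size_rev ?lti //; lia.
- by rewrite !onth_default ?size_rcons ?size_rev //; lia.
- by rewrite (onth_lt false) ?size_rcons ?size_rev // nth_rcons size_rev ltnn eqxx.
Qed.

Lemma scell_set (s : store) r x i :
  scell (set r x s) i = cset (scell s i) r (onth (rev x) i).
Proof. by rewrite /scell qmap_set. Qed.

Lemma get_scell (s : store) r i : get r (scell s i).2 = onth (rev (get r s)) i.
Proof. by rewrite get_qmap. Qed.

Lemma upd_push (s : store) r b :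
  upd (scell s) (size (get r s)) (cset (scell s (size (get r s))) r (Some b))
  =1 scell (set r (b :: get r s) s).
Proof.
move=> i; rewrite scell_set onth_rev_cons /upd; case: eqP => [->//|_].
by rewrite /cset -get_scell set_get; case: (scell s i).
Qed.

Lemma upd_pop (s : store) r b x : get r s = b :: x ->
  upd (scell s) (size x) (cset (scell s (size x)) r None) =1 scell (set r x s).
Proof.
move=> E i; rewrite scell_set /upd; case: eqP => [->|/eqP/negbTE ne].
  by rewrite onth_rev_ge.
have -> : onth (rev x) i = get r (scell s i).2.
  by rewrite get_scell E onth_rev_cons ne.
by rewrite /cset set_get; case: (scell s i).
Qed.

Lemma inord_le n : n <= L -> (inord n : 'I_L.+1) = n :> nat.
Proof. by move=> le; rewrite inordK. Qed.

Lemma back_home c n s pos : n <= L ->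
  represents c (inl (Back n)) pos (scell s) ->
  exists2 t, t <= pos.+1 & at_home (iter t (@tm_step machine) c) n s.
Proof.
move=> leL Rc; exists pos.+1 => //; rewrite iterS.
have R0c : represents (iter pos (@tm_step machine) c) (inl (Back n)) 0 (scell s).
  by apply: walk_left Rc => i /andP[i_gt0 _]; rewrite /= /scell (gtn_eqF i_gt0).
have := represents_step R0c (erefl _); rewrite /= inord_le //.
exact/represents_ext/upd_same.
Qed.

Lemma mdelta_seek n s :
  n <= L -> mdelta (Seek n) s =
      match fetch n with
      | IJmp n => (inl (Seek n), s, Stay)
      | IHalt b => (inr b, s, Stay)
      | IPush r b n' =>
          if get r s.2 is None then (inl (Back n'), cset s r (Some b), Stay)
          else (inl (Seek n), s, MoveR)
      | IPop r n0 n1 n2 =>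
          if get r s.2 is None then
            if s.1 then (inl (Seek n0), s, Stay) else (inl (Take n), s, MoveL)
          else (inl (Seek n), s, MoveR)
      end.
Proof. by move=> leL; rewrite /= inord_le. Qed.

Lemma machine_jmp c n n' s : n <= L -> fetch n = IJmp n' -> at_home c n s ->
  at_home (tm_step c) n' s.
Proof.
move=> leL E Rc; have := @represents_step _ _ _ _ (inl (Seek n')) (scell s 0) Stay Rc.
rewrite mdelta_seek // E => /(_ erefl).
exact/represents_ext/upd_same.
Qed.

Lemma machine_push c n n' r b s : n <= L -> n' <= L -> fetch n = IPush r b n' ->
  at_home c n s ->
  exists2 t, t <= (size (get r s)).*2 + 2
    & at_home (iter t (@tm_step machine) c) n' (set r (b :: get r s) s).
Proof.
move=> leL leL' E Rc; set m := size (get r s).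
have Rm : represents (iter m (@tm_step machine) c) (inl (Seek n)) m (scell s).
  rewrite -[m in X in _ X _]add0n; apply: walk_right Rc => i /= lti.
  rewrite [LHS]mdelta_seek // E get_scell.
  by have [b' ->] := onth_rev_lt lti.
have := @represents_step _ _ _ _ (inl (Back n')) (cset (scell s m) r (Some b)) Stay Rm.
rewrite mdelta_seek // E get_scell onth_rev_ge // => /(_ erefl) Rb.
have {}Rb := represents_ext (@upd_push s r b) Rb.
have [t let_ Rt] := back_home leL' Rb.
by exists (t + m.+1); [rewrite -/m; lia | rewrite iterD].
Qed.

Lemma machine_pop0 c n n0 n1 n2 r s : n <= L -> fetch n = IPop r n0 n1 n2 ->
  get r s = [::] -> at_home c n s -> at_home (tm_step c) n0 s.
Proof.
move=> leL E Er Rc.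
have := @represents_step _ _ _ _ (inl (Seek n0)) (scell s 0) Stay Rc.
rewrite mdelta_seek // E get_scell Er => /(_ erefl).
exact/represents_ext/upd_same.
Qed.

Lemma machine_pop1 c n n0 n1 n2 r b x s : n <= L -> n1 <= L -> n2 <= L ->
  fetch n = IPop r n0 n1 n2 ->
  get r s = b :: x -> at_home c n s ->
  exists2 t, t <= (size (get r s)).*2 + 2
    & at_home (iter t (@tm_step machine) c) (if b then n2 else n1) (set r x s).
Proof.
move=> leL leL1 leL2 E Er Rc; set m := size (get r s).
have mE : m = (size x).+1 by rewrite /m Er.
have Rm : represents (iter m (@tm_step machine) c) (inl (Seek n)) m (scell s).
  rewrite -[m in X in _ X _]add0n; apply: walk_right Rc => i /= lti.
  rewrite [LHS]mdelta_seek // E get_scell.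
  by have [b' ->] := onth_rev_lt lti.
have := @represents_step _ _ _ _ (inl (Take n)) (scell s m) MoveL Rm.
rewrite mdelta_seek // E get_scell onth_rev_ge // {1}mE => /(_ erefl).
rewrite mE => /(_ isT) Rt; have {}Rt := represents_ext (@upd_same _ _) Rt.
have eb : (Some b == Some true) = b by case: (b).
have := @represents_step _ _ _ _ (inl (Back (if b then n2 else n1)))
  (cset (scell s (size x)) r None) Stay Rt.
rewrite /= inord_le // E get_scell Er onth_rev_cons eqxx eb => /(_ erefl) Rb.
have {}Rb := represents_ext (upd_pop Er) Rb.
have leLb : (if b then n2 else n1) <= L by case: (b).
have [t let_ Rt'] := back_home leLb Rb.
by exists (t + m.+2); [rewrite -/m mE; lia | rewrite iterD mE].
Qed.

Definition code_at pc (p : seq instr) :=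
  forall i, i < size p -> fetch (pc + i) = nth (IHalt false) p i.

Lemma code_at_cat pc p1 p2 :
  code_at pc (p1 ++ p2) -> code_at pc p1 /\ code_at (pc + size p1) p2.
Proof.
move=> H; split=> i lti; first by rewrite H ?nth_cat ?lti // size_cat; lia.
by rewrite -addnA H ?nth_cat ?size_cat; [rewrite ltnNge leq_addr /= addKn | lia].
Qed.

Lemma code_at_cons pc i p :
  code_at pc (i :: p) -> fetch pc = i /\ code_at pc.+1 p.
Proof.
rewrite -cat1s => /code_at_cat[H1 H2]; split; last by rewrite addn1 in H2.
by have := H1 0 isT; rewrite addn0.
Qed.

(** [B] dominates the store size plus the remaining time, a quantity that does not increase by
    [exec_ssize]. Hence no stack exceeds [B] and the round trip of one instruction takes at most
    [B.*2 + 2] steps. *)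
Lemma exec_run c s t s' : exec c s t s' ->
  forall B pc nxt cf, ssize s + t <= B -> code_at pc (compile c pc nxt) ->
  pc + clen c <= L -> nxt <= L -> at_home cf pc s ->
  exists2 t', t' <= t * (B.*2 + 2)
    & at_home (iter t' (@tm_step machine) cf) nxt s'.
Proof.
elim=> {c s t s'} /=.
- move=> s B pc nxt cf HB /code_at_cons[E _] leL leN R.
  by exists 1; [lia | apply: machine_jmp E R; lia].
- move=> r b s B pc nxt cf HB /code_at_cons[E _] leL leN R.
  have [||t' t'le R'] := machine_push _ _ E R; [lia|lia|].
  by exists t' => //; have := get_ssize r s; lia.
- move=> r c0 c1 c2 s t s' Er _ IH B pc nxt cf HB /code_at_cons[E H] leL leN R.
  have [H0 _] := code_at_cat H.
  have R1 : at_home (tm_step cf) pc.+1 s by apply: machine_pop0 E Er R; lia.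
  have [||t' t'le R'] := IH B _ _ _ _ H0 _ leN R1; [lia|lia|].
  by exists (t' + 1); [nia | rewrite iterD].
- move=> r c0 c1 c2 b x s t s' Er _ IH B pc nxt cf HB /code_at_cons[E H] leL leN R.
  have [_] := code_at_cat H; rewrite size_compile => /code_at_cat[H1].
  rewrite size_compile => H2.
  have [|||t1 t1le R1] := machine_pop1 _ _ _ E Er R; [lia|lia|lia|].
  have szx := ssize_set r x s; rewrite Er /= in szx.
  have [|||t' t'le R'] := IH B (if b then pc.+1 + clen c0 + clen c1 else pc.+1 + clen c0) nxt _ _ _ _ leN R1.
  + lia.
  + by case: (b).
  + by case: (b); lia.
  exists (t' + t1); last by rewrite iterD.
  by have := get_ssize r s; nia.
- move=> c1 c2 s s' s'' t t' ex1 IH1 _ IH2 B pc nxt cf HB /code_at_cat[H1].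
  rewrite size_compile => H2 leL leN R; have sz := exec_ssize ex1.
  have [|||t1 t1le R1] := IH1 B _ _ _ _ H1 _ _ R; [lia|lia|lia|].
  have [||t2 t2le R2] := IH2 B _ _ _ _ H2 _ leN R1; [lia|lia|].
  by exists (t2 + t1); [nia | rewrite iterD].
- move=> r c1 c2 s Er B pc nxt cf HB /code_at_cons[E H] leL leN R.
  by exists 1; [lia | apply: machine_pop0 E Er R; lia].
- move=> r c1 c2 b x s s' s'' t t' Er ex1 IH1 _ IH2 B pc nxt cf HB H' leL leN R.
  have /code_at_cons[E H] := H'.
  have [H1] := code_at_cat H; rewrite size_compile => H2.
  have [|||t1 t1le R1] := machine_pop1 _ _ _ E Er R; [lia|lia|lia|].
  have szx := ssize_set r x s; rewrite Er /= in szx.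
  have sz := exec_ssize ex1.
  have [||||t2 t2le R2] := IH1 B (if b then pc.+1 + clen c1 else pc.+1) pc _ _ _ _ _ R1.
  + lia.
  + by case: (b).
  + by case: (b); lia.
  + lia.
  have [|t3 t3le R3] := IH2 B pc nxt _ _ H' leL leN R2; first lia.
  exists (t3 + (t2 + t1)); last by rewrite !iterD.
  by have := get_ssize r s; nia.
Qed.

(** Stacks grow to the right, so the untouched input already is stack [R0], with the last bit of [w]
    on top. *)
Lemma start_home w : at_home (tm_run machine 1 w) 0 (rev w, [::], [::], [::]).
Proof.
have E (h : 'I_#|cell|.+3) (r : seq 'I_#|cell|.+3) :
    @tm_step machine (ord0, [::], h, r) =
    (encq (inl (Seek 0)), [::], inj (true, (dec h).2), r).
  rewrite /tm_step /= /delta; case Ep: (proj _) => [i|q] //.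
  by move: Ep; rewrite /proj; case: splitP.
rewrite /at_home.
have -> : tm_run machine 1 w = (encq (inl (Seek 0)), [::],
    inj (true, (dec (head (blank machine) (map (@sym_of_bit machine) w))).2),
    behead (map (@sym_of_bit machine) w)).
  by case: w => [|b w]; exact: E.
split=> // i; rewrite /scell /= revK; case: w => [|b w] /=.
  case: i => [|i] /=; first by rewrite dec_inj dec_blank.
  by rewrite nth_nil dec_blank.
case: i => [|i] /=; first by rewrite dec_inj dec_bit.
have [lti|gei] := ltnP i (size w).
  by rewrite (nth_map false) // dec_bit (onth_lt false).
by rewrite nth_default ?size_map // dec_blank onth_default.
Qed.

End Machine.

Definition decider (c : cmd) : seq instr :=
  let n := clen c in
  compile c 0 n ++ [:: IPop R0 n.+1 n.+1 n.+2; IHalt false; IHalt true].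

(** The factor [t.+2] counts the [t] units of the program, the final pop of the answer, and one more
    unit that covers the marking step and the halting step. *)
Lemma decider_correct c w b x y z v t :
  exec c (rev w, [::], [::], [::]) t (b :: x, y, z, v) ->
  forall T, t.+2 * ((size w + t).*2 + 2) <= T ->
  tm_decides_within (machine (decider c)) w b T.
Proof.
move=> ex T HT; set code := decider c.
have szc : size code = clen c + 3 by rewrite size_cat size_compile.
have szw : ssize (rev w, [::], [::], [::]) = size w by rewrite /= size_rev; lia.
have cat : code_at code 0 code by move=> i lti; rewrite add0n.
have [H1] := code_at_cat cat; rewrite size_compile add0n.
move=> /code_at_cons[E1 /code_at_cons[E2 /code_at_cons[E3 _]]].
have [|||t1 t1le R1] := exec_run ex (B := size w + t) _ H1 _ _ (start_home code w).
- by rewrite szw.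
- by rewrite szc; lia.
- by rewrite szc; lia.
have [|||t2 t2le R2] := machine_pop1 _ _ _ E1 (erefl : get R0 (b :: x, y, z, v) = b :: x) R1.
- lia.
- lia.
- lia.
have le3 : (if b then (clen c).+2 else (clen c).+1) <= size code by case: (b); lia.
have := @represents_step code _ _ _ _ (inr b) (scell (set R0 x (b :: x, y, z, v)) 0) Stay R2.
rewrite mdelta_seek //.
have -> : fetch code (if b then (clen c).+2 else (clen c).+1) = IHalt b by case: (b).
move=> /(_ erefl); set f := upd _ _ _ => R3'.
have R3 : represents (iter (t2 + (t1 + 1)).+1 (@tm_step (machine code))
    (tm_init (machine code) w)) (inr b) 0 f.
  by rewrite iterS !iterD.
have sx := exec_ssize ex; rewrite szw /= in sx.
have t3le : (t2 + (t1 + 1)).+1 <= T.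
  by move: t2le => /=; nia.
rewrite /tm_decides_within /tm_run.
rewrite -(subnK t3le) iterD.
move: (T - _) R3 => n {R3'}; case: (iter _ _ _) => [[[q l] h] r] [-> _ _].
have hb : halted (encq (inr b) : 'I_(tm_Q (machine code)).+3) by case: (b).
elim: n => [|n IH]; first by rewrite /=; case: (b).
by rewrite iterSr /tm_step hb.
Qed.

(** * Polynomial-time functions *)

(** The shape of the time bound in the theorem; a single parameter for factor and exponent keeps the
    existential statements short. *)
Definition pb (c n : nat) : nat := c * n.+1 ^ c.

Definition polyb (g : nat -> nat) := exists c, forall n, g n <= pb c n.

Lemma leq_expn2r e m n : m <= n -> m ^ e <= n ^ e.
Proof. by case: e => // e le; rewrite leq_exp2r. Qed.

Lemma pb_mono c m n : m <= n -> pb c m <= pb c n.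
Proof. by move=> le; rewrite leq_mul2l leq_expn2r ?orbT. Qed.

Lemma polyb_pb c : polyb (pb c). Proof. by exists c. Qed.

Lemma polyb_id : polyb id.
Proof. by exists 1 => n; rewrite /pb expn1; lia. Qed.

Lemma polyb_const k : polyb (fun=> k).
Proof. by exists k => n; rewrite /pb leq_pmulr // expn_gt0. Qed.

Lemma polyb_le f g : polyb g -> (forall n, f n <= g n) -> polyb f.
Proof. by move=> [c H] le; exists c => n; apply: leq_trans (H n). Qed.

Lemma polyb_add f g : polyb f -> polyb g -> polyb (fun n => f n + g n).
Proof.
move=> [c Hc] [d Hd]; exists (c + d) => n.
apply: leq_trans (leq_add (Hc n) (Hd n)) _; rewrite /pb mulnDl leq_add //.
  by rewrite leq_mul // leq_pexp2l // leq_addr.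
by rewrite leq_mul // leq_pexp2l // leq_addl.
Qed.

Lemma polyb_mul f g : polyb f -> polyb g -> polyb (fun n => f n * g n).
Proof.
move=> [c Hc] [d Hd]; exists (c * d + c + d) => n.
apply: leq_trans (leq_mul (Hc n) (Hd n)) _.
rewrite /pb mulnACA -expnD leq_mul // ?leq_pexp2l //; lia.
Qed.

Lemma polyb_comp f g : polyb f -> polyb g -> polyb (fun n => f (g n)).
Proof.
move=> [c Hc] [d Hd]; exists (c * d.+1 ^ c + d * c) => n.
apply: leq_trans (Hc _) _; apply: leq_trans (pb_mono c (Hd n)) _.
apply: leq_trans (_ : c * (d.+1 * n.+1 ^ d) ^ c <= _).
  rewrite /pb leq_mul2l leq_expn2r ?orbT //.
  by have : 0 < n.+1 ^ d; [rewrite expn_gt0 | nia].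
rewrite expnMn mulnA -expnM /pb leq_mul ?leq_addr // leq_pexp2l //; lia.
Qed.

Lemma polyb_S f : polyb f -> polyb (fun n => (f n).+1).
Proof.
move=> pf; apply: polyb_le (polyb_add pf (polyb_const 1)) _ => n; lia.
Qed.

Ltac polyb := repeat match goal with
  | |- polyb (pb _) => exact: polyb_pb
  | |- polyb id => exact: polyb_id
  | |- polyb (fun n => n) => exact: polyb_id
  | |- polyb (fun=> _) => exact: polyb_const
  | |- polyb (fun n => pb ?c (@?g n)) =>
      apply: (@polyb_comp (pb c) g); first exact: polyb_pb
  | |- polyb (fun n => (@?f n).+1) => apply: (@polyb_S f)
  | |- polyb (fun n => @?f n + @?g n) => apply: (@polyb_add f g)
  | |- polyb (fun n => @?f n * @?g n) => apply: (@polyb_mul f g)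
  end.

(** * Binary trees as data, and functions on their codes *)

Inductive tree := Nil | Cons of tree & tree.

(** A prefix code: the end of a tree is recognised without a separator, so codes can be stacked on
    one another. *)
Fixpoint code (t : tree) : seq bool :=
  if t is Cons a b then true :: code a ++ code b else [:: false].

Structure ctype := CType { csort :> Type; enc : csort -> tree }.

Definition tsz (A : ctype) (x : A) : nat := size (code (enc x)).

(** With this choice the first bit of the code is the boolean itself, ready for the final pop, and a
    test on a boolean has the same form as a test for a nonempty list. *)
Definition enc_bool (b : bool) := if b then Cons Nil Nil else Nil.

Canonical unit_ctype := @CType unit (fun=> Nil).
Canonical bool_ctype := CType enc_bool.
Canonical prod_ctype (A B : ctype) :=
  @CType (A * B)%type (fun z => Cons (enc z.1) (enc z.2)).
Definition enc_seq (A : ctype) (l : seq A) := foldr (fun x t => Cons (enc x) t) Nil l.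
Canonical seq_ctype (A : ctype) := @CType (seq A) (@enc_seq A).

Lemma tsz_pair (A B : ctype) (z : A * B) : tsz z = (tsz z.1 + tsz z.2).+1.
Proof. by rewrite /tsz /= size_cat. Qed.

Lemma tsz_cons (A : ctype) (x : A) l : tsz (x :: l) = (tsz x + tsz l).+1.
Proof. by rewrite /tsz /= size_cat. Qed.

Lemma tsz_nil (A : ctype) : tsz (@nil A) = 1.
Proof. by []. Qed.

Lemma tsz_gt0 (A : ctype) (x : A) : 0 < tsz x.
Proof. by rewrite /tsz; case: (enc x). Qed.

Lemma size_tsz (A : ctype) (l : seq A) : size l < tsz l.
Proof. by elim: l => //= x l IH; rewrite tsz_cons; lia. Qed.

Definition run c s n s' := exists2 t, t <= n & exec c s t s'.

Lemma run_le c s m n s' : m <= n -> run c s m s' -> run c s n s'.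
Proof. by move=> le [t tm ex]; exists t => //; apply: leq_trans le. Qed.

Lemma run_skip s : run Skip s 1 s.
Proof. by exists 1 => //; constructor. Qed.

Lemma run_push r b s : run (Push r b) s 1 (set r (b :: get r s) s).
Proof. by exists 1 => //; constructor. Qed.

Lemma run_pop c0 c1 c2 r b x s n s' : get r s = b :: x ->
  run (if b then c2 else c1) (set r x s) n s' -> run (Pop r c0 c1 c2) s n.+1 s'.
Proof. by move=> E [t tn ex]; exists t.+1 => //; apply: EPop1 E ex. Qed.

Lemma run_seq c1 c2 s m s' n s'' :
  run c1 s m s' -> run c2 s' n s'' -> run (Seq c1 c2) s (m + n) s''.
Proof.
by move=> [t tm ex] [t' tn ex']; exists (t + t'); [rewrite leq_add | apply: ESeq ex ex'].
Qed.

Lemma run_loop0 r c1 c2 s : get r s = [::] -> run (Loop r c1 c2) s 1 s.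
Proof. by move=> E; exists 1 => //; apply: ELoop0. Qed.

Lemma run_loop1 r c1 c2 b x s m s' n s'' : get r s = b :: x ->
  run (if b then c2 else c1) (set r x s) m s' -> run (Loop r c1 c2) s' n s'' ->
  run (Loop r c1 c2) s (m + n).+1 s''.
Proof.
move=> E [t tm ex] [t' tn ex']; exists (t + t').+1; first by rewrite ltnS leq_add.
exact: ELoop1 E ex ex'.
Qed.

Definition mv_loop src :=
  Loop R2 Skip (Pop src Skip (Push R3 false)
    (Seq (Push R3 true) (Seq (Push R2 true) (Push R2 true)))).

(* Moves one tree code, reversed, to [R3]; [R2] counts the subtrees left. *)
Definition mv src := Seq (Push R2 true) (mv_loop src).

Definition mkst (first : bool) (x y c d : seq bool) : store :=
  if first then (x, y, c, d) else (y, x, c, d).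

(** Stated relative to an arbitrary continuation of the loop, so that the two subtrees of a node are
    handled by chaining the induction hypotheses. *)
Lemma run_mv_loop (f : bool) t s y c d n s' :
  run (mv_loop (if f then R0 else R1)) (mkst f s y c (rev (code t) ++ d)) n s' ->
  run (mv_loop (if f then R0 else R1)) (mkst f (code t ++ s) y (true :: c) d)
      (5 * size (code t) + n) s'.
Proof.
elim: t s c d n => [|a IHa b IHb] s c d n R.
  apply: (@run_le _ _ (2 + n).+1); first by rewrite /=; lia.
  apply: (@run_loop1 _ _ _ true c _ _ (mkst f s y c (false :: d))).
  - by case: (f).
  - apply: (@run_pop _ _ _ _ false s); first by case: (f).
    by have := run_push R3 false (mkst f s y c d); case: (f).
  - exact: R.
apply: (@run_le _ _ (4 + (5 * size (code a) + (5 * size (code b) + n))).+1).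
  by rewrite /= size_cat; lia.
apply: (@run_loop1 _ _ _ true c _ _
         (mkst f (code a ++ code b ++ s) y (true :: true :: c) (true :: d))).
- by case: (f).
- apply: (@run_pop _ _ _ _ true (code a ++ code b ++ s)).
    by rewrite /= -catA; case: (f).
  have := run_seq (run_push R3 true (mkst f (code a ++ code b ++ s) y c d))
    (run_seq (run_push R2 true _) (run_push R2 true _)).
  by case: (f).
- apply/IHa/IHb; rewrite /= in R.
  by rewrite catA -rev_cat -cat_rcons -rev_cons.
Qed.

Lemma run_mv (f : bool) t s y d :
  run (mv (if f then R0 else R1)) (mkst f (code t ++ s) y [::] d)
      (5 * size (code t) + 2) (mkst f s y [::] (rev (code t) ++ d)).
Proof.
apply: (@run_le _ _ (1 + (5 * size (code t) + 1))); first lia.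
apply: (run_seq (s' := mkst f (code t ++ s) y [:: true] d)).
  by have := run_push R2 true (mkst f (code t ++ s) y [::] d); case: (f).
by apply: run_mv_loop; apply: run_loop0; case: (f).
Qed.

(** [R3] holds a code reversed, so unloading it restores the order; unloading onto two stacks at
    once makes a copy. *)
Definition unmv0 := Loop R3 (Push R0 false) (Push R0 true).
Definition unmv1 := Loop R3 (Push R1 false) (Push R1 true).
Definition unmv01 := Loop R3 (Seq (Push R0 false) (Push R1 false))
                             (Seq (Push R0 true) (Push R1 true)).
Definition clear := Loop R3 Skip Skip.

Lemma run_unmv0 d x y z :
  run unmv0 (x, y, z, d) (2 * size d + 1) (rev d ++ x, y, z, [::]).
Proof.
elim: d x => [|b d IH] x; first exact: run_loop0.
apply: (@run_le _ _ (1 + (2 * size d + 1)).+1); first by rewrite /=; lia.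
apply: (@run_loop1 _ _ _ b d _ _ (b :: x, y, z, d)) => //.
  by case: b; apply: run_push.
by rewrite rev_cons cat_rcons.
Qed.

Lemma run_unmv1 d x y z :
  run unmv1 (x, y, z, d) (2 * size d + 1) (x, rev d ++ y, z, [::]).
Proof.
elim: d y => [|b d IH] y; first exact: run_loop0.
apply: (@run_le _ _ (1 + (2 * size d + 1)).+1); first by rewrite /=; lia.
apply: (@run_loop1 _ _ _ b d _ _ (x, b :: y, z, d)) => //.
  by case: b; apply: run_push.
by rewrite rev_cons cat_rcons.
Qed.

Lemma run_unmv01 d x y z :
  run unmv01 (x, y, z, d) (3 * size d + 1) (rev d ++ x, rev d ++ y, z, [::]).
Proof.
elim: d x y => [|b d IH] x y; first exact: run_loop0.
apply: (@run_le _ _ (2 + (3 * size d + 1)).+1); first by rewrite /=; lia.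
apply: (@run_loop1 _ _ _ b d _ _ (b :: x, b :: y, z, d)) => //.
  by case: b; apply: (run_seq (run_push _ _ _)); apply: run_push.
by rewrite rev_cons !cat_rcons.
Qed.

Lemma run_clear d x y z : run clear (x, y, z, d) (2 * size d + 1) (x, y, z, [::]).
Proof.
elim: d => [|b d IH]; first exact: run_loop0.
apply: (@run_le _ _ (1 + (2 * size d + 1)).+1); first by rewrite /=; lia.
apply: (@run_loop1 _ _ _ b d _ _ (x, y, z, d)) => //.
by case: b; apply: run_skip.
Qed.

Definition droptop := Seq (mv R0) clear.

Lemma run_droptop t x y :
  run droptop (code t ++ x, y, [::], [::]) (7 * size (code t) + 3) (x, y, [::], [::]).
Proof.
apply: run_le (run_seq (run_mv true t x y [::]) (run_clear _ _ _ _)).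
by rewrite cats0 size_rev; lia.
Qed.

Definition pull := Seq (mv R1) unmv0.

Lemma run_pull t x y :
  run pull (x, code t ++ y, [::], [::]) (7 * size (code t) + 3) (code t ++ x, y, [::], [::]).
Proof.
have := run_unmv0 (rev (code t) ++ [::]) x y [::].
rewrite cats0 revK size_rev => H.
have := run_mv false t y x [::]; rewrite cats0 => H'.
by apply: run_le (run_seq H' H); lia.
Qed.

(* [R0] is a stack of tree codes and [R1] a save area; as their rests [r0], [r1]
   are arbitrary, programs can be run on top of pending data. *)
Definition ptime (A B : ctype) (f : A -> B) : Prop :=
  exists cm c, forall x r0 r1,
    run cm (code (enc x) ++ r0, r1, [::], [::]) (pb c (tsz x))
           (code (enc (f x)) ++ r0, r1, [::], [::]).

Lemma ptimeI (A B : ctype) (f : A -> B) cm g : polyb g ->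
  (forall x r0 r1, run cm (code (enc x) ++ r0, r1, [::], [::]) (g (tsz x))
                          (code (enc (f x)) ++ r0, r1, [::], [::])) ->
  ptime f.
Proof. by move=> [c Hc] H; exists cm, c => x r0 r1; apply: run_le (H x r0 r1). Qed.

Lemma ptime_enc (A B B' : ctype) (f : A -> B) (g : A -> B') :
  (forall x, enc (f x) = enc (g x)) -> ptime f -> ptime g.
Proof. by move=> E [cm [c H]]; exists cm, c => x r0 r1; rewrite -E. Qed.

Lemma eq_ptime (A B : ctype) (f g : A -> B) : f =1 g -> ptime f -> ptime g.
Proof. by move=> E; apply: ptime_enc => x; rewrite E. Qed.

(** A program cannot write more bits than its running time; closure under composition depends on
    this. *)
Lemma ptime_size (A B : ctype) (f : A -> B) : ptime f ->
  exists c, forall x, tsz (f x) <= pb c (tsz x).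
Proof.
move=> [cm [c H]].
have [c' Hc'] : polyb (fun n => n + pb c n) by polyb.
exists c' => x; apply: leq_trans (Hc' _).
have [t tle /exec_ssize] := H x [::] [::]; rewrite /= !cats0 !addn0.
rewrite /tsz => le; apply: leq_trans le _; rewrite leq_add2l; exact: tle.
Qed.

Lemma ptime_id (A : ctype) : ptime (fun x : A => x).
Proof. by exists Skip, 1 => x r0 r1; apply: run_le (run_skip _). Qed.

Lemma ptime_comp (A B C : ctype) (f : A -> B) (g : B -> C) :
  ptime f -> ptime g -> ptime (fun x => g (f x)).
Proof.
move=> pf [cm [c H]]; have [d Hd] := ptime_size pf; case: pf => cm' [c' H'].
apply: (@ptimeI _ _ _ (Seq cm' cm) (fun n => pb c' n + pb c (pb d n))).
  polyb.
move=> x r0 r1 /=; apply: (run_seq (H' x r0 r1)).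
exact: run_le (pb_mono _ (Hd x)) (H (f x) r0 r1).
Qed.

Lemma run_pushes (l : seq bool) :
  exists cm, forall x y z v,
    run cm (x, y, z, v) (size l).+1 (catrev l x, y, z, v).
Proof.
elim: l => [|b l [cm H]]; first by exists Skip => *; apply: run_skip.
exists (Seq (Push R0 b) cm) => x y z v.
apply: (@run_le _ _ (1 + (size l).+1)) => //.
exact: (run_seq (run_push R0 b (x, y, z, v)) (H (b :: x) y z v)).
Qed.

Lemma ptime_const (A B : ctype) (b : B) : ptime (fun _ : A => b).
Proof.
have [cm H] := run_pushes (rev (code (enc b))).
apply: (@ptimeI _ _ _ (Seq droptop cm) (fun n => 7 * n + 3 + (size (code (enc b))).+1)).
  polyb.
move=> x r0 r1; rewrite /tsz; apply: run_seq (run_droptop _ _ _) _.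
have := H r0 r1 [::] [::]; rewrite size_rev.
by rewrite catrevE revK.
Qed.

Lemma ptime_snd (A B : ctype) : ptime (fun z : A * B => z.2).
Proof.
apply: (@ptimeI _ _ _ (Pop R0 Skip Skip droptop) (fun n => 7 * n + 4)); first polyb.
move=> [a b] r0 r1 /=.
apply: (@run_le _ _ (7 * size (code (enc a)) + 3).+1).
  by rewrite tsz_pair /tsz /=; lia.
apply: (@run_pop _ _ _ _ true (code (enc a) ++ code (enc b) ++ r0)).
  by rewrite /= catA.
exact: run_droptop.
Qed.

Lemma ptime_fst (A B : ctype) : ptime (fun z : A * B => z.1).
Proof.
apply: (@ptimeI _ _ _ (Pop R0 Skip Skip (Seq (Seq (mv R0) unmv1) (Seq droptop pull)))
         (fun n => 14 * n + 10)); first polyb.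
move=> [a b] r0 r1 /=.
set na := size (code (enc a)); set nb := size (code (enc b)).
apply: (@run_le _ _ ((5 * na + 2) + (2 * na + 1) + ((7 * nb + 3) + (7 * na + 3))).+1).
  by rewrite tsz_pair /tsz /= -/na -/nb; lia.
apply: (@run_pop _ _ _ _ true (code (enc a) ++ code (enc b) ++ r0)).
  by rewrite /= catA.
apply: run_seq; last by apply: run_seq (run_droptop _ _ _) (run_pull _ _ _).
have := run_unmv1 (rev (code (enc a))) (code (enc b) ++ r0) r1 [::].
rewrite revK size_rev; apply: run_seq.
by have := run_mv true (enc a) (code (enc b) ++ r0) r1 [::]; rewrite cats0.
Qed.

(** The argument is copied to the save area and [g] runs on the remaining copy; the saved one is
    pulled on top of the result, [f] runs there, and one pushed bit forms the pair node. *)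
Lemma ptime_pair (A B C : ctype) (f : A -> B) (g : A -> C) :
  ptime f -> ptime g -> ptime (fun x => (f x, g x)).
Proof.
move=> [cf [nf Hf]] [cg [ng Hg]].
apply: (@ptimeI _ _ _ (Seq (Seq (mv R0) unmv01) (Seq cg (Seq pull (Seq cf (Push R0 true)))))
  (fun n => 5 * n + 2 + (3 * n + 1) + (pb ng n + ((7 * n + 3) + (pb nf n + 1))))).
  polyb.
move=> x r0 r1; rewrite /tsz /=; apply: (run_seq (s' := (code (enc x) ++ r0, code (enc x) ++ r1, [::], [::]))).
  have := run_unmv01 (rev (code (enc x))) r0 r1 [::].
  rewrite revK size_rev; apply: run_seq.
  by have := run_mv true (enc x) r0 r1 [::]; rewrite cats0.
apply: run_seq (Hg _ _ _) _; apply: run_seq (run_pull _ _ _) _.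
apply: run_seq (Hf _ _ _) _; rewrite -catA.
exact: run_push.
Qed.

(** Common source of the case analyses on booleans and on lists. In the nonempty case the two
    inspected bits are pushed back: the code of [(t, a)] then is literally that of [(x, a)]. *)
Lemma ptime_view (T A B X : ctype) (v : T -> option X) (G : A -> B) (F : X * A -> B) :
  (forall t, if v t is Some x then enc t = enc x else enc t = Nil) ->
  (forall x : X, exists a b, enc x = Cons a b) ->
  ptime G -> ptime F ->
  ptime (fun z : T * A => if v z.1 is Some x then F (x, z.2) else G z.2).
Proof.
move=> Hv HX [cg [ng Hg]] [cf [nf Hf]].
apply: (@ptimeI _ _ _ (Pop R0 Skip Skip (Pop R0 Skip cg
    (Seq (Seq (Push R0 true) (Push R0 true)) cf)))
  (fun n => pb ng n + pb nf n + 4)); first polyb.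
move=> [t a] r0 r1 /=.
have := Hv t; case: (v t) => [x|] E.
  have [u [w Ex]] := HX x.
  apply: (@run_le _ _ (2 + pb nf (tsz (x, a))).+2).
    by rewrite !tsz_pair /tsz /= E; lia.
  apply: (@run_pop _ _ _ _ true (code (enc t) ++ code (enc a) ++ r0)).
    by rewrite /= catA.
  rewrite E Ex; apply: (@run_pop _ _ _ _ true (code u ++ code w ++ code (enc a) ++ r0)).
    by rewrite /= -!catA.
  have := Hf (x, a) r0 r1; apply: run_seq.
  rewrite /= Ex /= -!catA; exact: (run_seq (run_push _ _ _) (run_push _ _ _)).
apply: (@run_le _ _ (pb ng (tsz a)).+2).
  have : pb ng (tsz a) <= pb ng (tsz (t, a)) by apply: pb_mono; rewrite tsz_pair /=; lia.
  lia.
apply: (@run_pop _ _ _ _ true (code (enc t) ++ code (enc a) ++ r0)).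
  by rewrite /= catA.
rewrite E; apply: (@run_pop _ _ _ _ false (code (enc a) ++ r0)) => //.
exact: Hg.
Qed.

Lemma ptime_if (A B : ctype) (b : A -> bool) (f g : A -> B) :
  ptime b -> ptime f -> ptime g -> ptime (fun a => if b a then f a else g a).
Proof.
move=> pb_ pf pg; pose v (c : bool) := if c then Some (tt, tt) else None.
have H : ptime (fun z : bool * A => if v z.1 is Some x then f (x, z.2).2 else g z.2).
  apply: (@ptime_view bool_ctype A B (unit * unit)%type v g (fun z => f z.2)) => //.
  - by case.
  - by move=> x; exists Nil, Nil.
  - exact: ptime_comp (@ptime_snd _ _) pf.
have pba : ptime (fun a => (b a, a)) by apply: ptime_pair pb_ (@ptime_id _).
by apply: eq_ptime (ptime_comp pba H) => a /=; case: (b a).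
Qed.

Lemma ptime_case (A B X : ctype) (l : A -> seq X) (g : A -> B)
    (f : A -> X -> seq X -> B) :
  ptime l -> ptime g -> ptime (fun z : A * X * seq X => f z.1.1 z.1.2 z.2) ->
  ptime (fun a => if l a is x :: l' then f a x l' else g a).
Proof.
move=> pl pg pf.
pose v (c : seq X) := if c is x :: l' then Some (x, l') else None.
have H : ptime (fun z : seq X * A =>
    if v z.1 is Some x then f (x, z.2).2 (x, z.2).1.1 (x, z.2).1.2 else g z.2).
  apply: (@ptime_view (seq_ctype X) A B (X * seq X)%type v g
           (fun z => f z.2 z.1.1 z.1.2)) => //.
  - by case.
  - by move=> x; exists (enc x.1), (enc x.2).
  - apply: (ptime_comp (f := fun z => (z.2, z.1.1, z.1.2)) _ pf).
    apply: ptime_pair; first apply: ptime_pair; first exact: ptime_snd.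
      exact: ptime_comp (@ptime_fst _ _) (@ptime_fst _ _).
    exact: ptime_comp (@ptime_fst _ _) (@ptime_snd _ _).
have pla : ptime (fun a => (l a, a)) by apply: ptime_pair pl (@ptime_id _).
by apply: eq_ptime (ptime_comp pla H) => a /=; case: (l a).
Qed.

(** A pair and a nonempty list have the same code. *)
Lemma ptime_cons (A X : ctype) (f : A -> X) (g : A -> seq X) :
  ptime f -> ptime g -> ptime (fun a => f a :: g a).
Proof. by move=> pf pg; apply: ptime_enc (ptime_pair pf pg). Qed.

(** Peeks at the list inside [(l, (a, y))]: the inspected bits are restored, and [R2] receives a
    flag exactly when [l] is nonempty. The loop pops the flag, so its body starts with [R2]
    empty. *)
Definition test :=
  Pop R0 Skip Skip (Pop R0 Skip
    (Seq (Push R0 false) (Push R0 true))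
    (Seq (Seq (Push R0 true) (Push R0 true)) (Push R2 true))).

Definition foldl_loop cf := Seq test (Loop R2 Skip (Seq cf test)).

Section Foldl.
Variables (A X Y : ctype) (F : A -> Y -> X -> Y).

Let st (l : seq X) (a : A) (y : Y) := code (enc (l, (a, y))).

Definition flag (l : seq X) := if l is [::] then [::] else [:: true].

Lemma run_test l a y r0 r1 :
  run test (st l a y ++ r0, r1, [::], [::]) 5 (st l a y ++ r0, r1, flag l, [::]).
Proof.
case: l => [|x l].
  apply: (@run_le _ _ (1 + 1).+2) => //.
  apply: (@run_pop _ _ _ _ true (behead (st [::] a y ++ r0))) => //.
  apply: (@run_pop _ _ _ _ false (behead (behead (st [::] a y ++ r0)))) => //.
  exact: run_seq (run_push _ _ _) (run_push _ _ _).
apply: (@run_le _ _ (1 + 1 + 1).+2) => //.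
apply: (@run_pop _ _ _ _ true (behead (st (x :: l) a y ++ r0))) => //.
apply: (@run_pop _ _ _ _ true (behead (behead (st (x :: l) a y ++ r0)))) => //.
exact: (run_seq (run_seq (run_push _ _ _) (run_push _ _ _)) (run_push _ _ _)).
Qed.

Definition fold_step (z : X * seq X * (A * Y)) : seq X * (A * Y) :=
  (z.1.2, (z.2.1, F z.2.1 z.2.2 z.1.1)).

Lemma run_foldl cf c K : (forall z r0 r1,
    run cf (code (enc z) ++ r0, r1, [::], [::]) (pb c (tsz z))
           (code (enc (fold_step z)) ++ r0, r1, [::], [::])) ->
  forall l a y r0 r1,
  (forall i, i <= size l -> tsz (foldl (F a) y (take i l)) <= K) ->
  run (foldl_loop cf) (st l a y ++ r0, r1, [::], [::])
      (5 + (size l).+1 * (pb c (tsz l + tsz a + K + 2) + 6))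
      (st [::] a (foldl (F a) y l) ++ r0, r1, [::], [::]).
Proof.
move=> H l a y r0 r1 HK; apply: run_seq (run_test _ _ _ _ _) _.
elim: l y HK => [|x l IH] y HK.
  apply: (@run_le _ _ 1); first by lia.
  exact: run_loop0.
set T := pb _ _.
have IH' : run (Loop R2 Skip (Seq cf test))
    (st l a (F a y x) ++ r0, r1, flag l, [::]) ((size l).+1 * (T + 6))
    (st [::] a (foldl (F a) (F a y x) l) ++ r0, r1, [::], [::]).
  apply: run_le (IH (F a y x) _); last by move=> i lei; apply: (HK i.+1).
  rewrite leq_mul2l leq_add2r pb_mono ?orbT // tsz_cons; lia.
apply: (@run_le _ _ (T + 5 + (size l).+1 * (T + 6)).+1); first by rewrite /=; lia.
apply: run_loop1 IH' => //.
apply: run_seq (run_test _ _ _ _ _).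
have := H (x, l, (a, y)) r0 r1; apply: run_le.
apply: pb_mono; rewrite !tsz_pair /= tsz_cons.
by have := HK 0 isT; rewrite take0 /=; lia.
Qed.

End Foldl.

(** A polynomial-time step may double the accumulator at each round; the size hypothesis on all
    prefixes excludes this. *)
Lemma ptime_foldl (A X Y : ctype) (l : A -> seq X) (y0 : A -> Y) (F : A -> Y -> X -> Y) :
  ptime l -> ptime y0 -> ptime (fun z : A * Y * X => F z.1.1 z.1.2 z.2) ->
  (exists c, forall a i, i <= size (l a) ->
     tsz (foldl (F a) (y0 a) (take i (l a))) <= pb c (tsz a)) ->
  ptime (fun a => foldl (F a) (y0 a) (l a)).
Proof.
move=> pl py pF [K HK].
have [cf [c Hc]] : ptime (@fold_step A X Y F).
  apply: ptime_pair; first exact: ptime_comp (@ptime_fst _ _) (@ptime_snd _ _).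
  apply: ptime_pair; first exact: ptime_comp (@ptime_snd _ _) (@ptime_fst _ _).
  apply: (ptime_comp (f := fun z => (z.2.1, z.2.2, z.1.1)) _ pF).
  apply: ptime_pair; first apply: ptime_pair.
  - exact: ptime_comp (@ptime_snd _ _) (@ptime_fst _ _).
  - exact: ptime_comp (@ptime_snd _ _) (@ptime_snd _ _).
  - exact: ptime_comp (@ptime_fst _ _) (@ptime_fst _ _).
have [cp [p Hp]] : ptime (fun a => (l a, (a, y0 a))).
  by do 2!apply: ptime_pair => //; apply: ptime_id.
have [cs [s Hs]] : ptime (fun z : seq X * (A * Y) => z.2.2).
  exact: ptime_comp (@ptime_snd _ _) (@ptime_snd _ _).
have [L HL] := ptime_size pl.
apply: (@ptimeI _ _ _ (Seq cp (Seq (foldl_loop cf) cs))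
  (fun n => pb p n + ((5 + (pb L n).+1 * (pb c (pb L n + n + pb K n + 2) + 6))
              + pb s (n + pb K n + 3)))); first polyb.
move=> a r0 r1; apply: run_seq (Hp _ _ _) _.
apply: run_seq.
  apply: run_le (run_foldl Hc r0 r1 (HK a)).
  rewrite leq_add2l leq_mul ?ltnS //.
    by apply: leq_trans (HL a); apply/ltnW/size_tsz.
  by rewrite leq_add2r pb_mono // !leq_add2r.
have := Hs ([::], (a, foldl (F a) (y0 a) (l a))) r0 r1; apply: run_le.
apply: pb_mono; rewrite !tsz_pair /= tsz_nil.
by have := HK a (size (l a)) (leqnn _); rewrite take_size; lia.
Qed.

(** Polynomially many steps, each adding a polynomial in the size of the parameter [a] only, keep
    every intermediate result polynomial. *)
Lemma ptime_foldl_inv (A X Y : ctype) (Inv : A -> Y -> Prop)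
    (l : A -> seq X) (y0 : A -> Y) (F : A -> Y -> X -> Y) :
  ptime l -> ptime y0 -> ptime (fun z : A * Y * X => F z.1.1 z.1.2 z.2) ->
  (forall a, Inv a (y0 a)) ->
  (exists c, forall a y x, Inv a y -> tsz x <= tsz (l a) ->
     Inv a (F a y x) /\ tsz (F a y x) <= tsz y + pb c (tsz a)) ->
  ptime (fun a => foldl (F a) (y0 a) (l a)).
Proof.
move=> pl py pF Inv0 [c Hc]; apply: ptime_foldl => //.
have [L HL] := ptime_size pl; have [y Hy] := ptime_size py.
have [K HK] : polyb (fun n => pb y n + pb L n * pb c n) by polyb.
exists K => a i lei; apply: leq_trans (HK _).
apply: leq_trans (_ : tsz (y0 a) + size (l a) * pb c (tsz a) <= _); last first.
  rewrite leq_add // leq_mul //; apply: leq_trans (HL a).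
  exact/ltnW/size_tsz.
suff H l' : tsz l' <= tsz (l a) -> forall y, Inv a y -> forall i, i <= size l' ->
    tsz (foldl (F a) y (take i l')) <= tsz y + size l' * pb c (tsz a).
  exact: H.
elim: l' => [|x l' IH] le y' Iy [|j] lej //=; rewrite ?leq_addr //.
rewrite tsz_cons in le; have [|Iy' ley] := Hc a y' x Iy; first lia.
apply: leq_trans (IH _ _ Iy' j lej) _; first lia.
by rewrite mulSn addnA leq_add2r.
Qed.

(** The input is popped from its last bit, which is the order in which a list code is built from its
    tail; the first push is the empty list. *)
Definition load_input :=
  Seq (Push R1 false)
   (Seq (Loop R0 (Seq (Push R1 false) (Push R1 true))
           (Seq (Seq (Push R1 false) (Push R1 false)) (Seq (Push R1 true) (Push R1 true))))
        pull).

Lemma tsz_bits (w : seq bool) : tsz w <= 4 * size w + 1.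
Proof. by elim: w => //= b w IH; rewrite tsz_cons; case: b; rewrite /tsz /= -/(tsz w); lia. Qed.

Lemma run_load_input w :
  run load_input (rev w, [::], [::], [::]) (35 * size w + 20)
      (code (enc w), [::], [::], [::]).
Proof.
set c1 := Seq (Push R1 false) (Push R1 true).
set c2 := Seq (Seq (Push R1 false) (Push R1 false)) (Seq (Push R1 true) (Push R1 true)).
have H (x l : seq bool) : run (Loop R0 c1 c2) (x, code (enc l), [::], [::])
    (5 * size x + 1) ([::], code (enc (catrev x l)), [::], [::]).
  elim: x l => [|b x IH] l; first exact: run_loop0.
  apply: (@run_le _ _ (4 + (5 * size x + 1)).+1); first by rewrite /=; lia.
  apply: (@run_loop1 _ _ _ b x _ _ (x, code (enc (b :: l)), [::], [::])) (IH _) => //.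
  case: b; last first.
    apply: (@run_le _ _ (1 + 1)) => //.
    exact: (run_seq (run_push _ _ _) (run_push _ _ _)).
  exact: (run_seq (run_seq (run_push _ _ _) (run_push _ _ _))
                  (run_seq (run_push _ _ _) (run_push _ _ _))).
apply: (@run_le _ _ (1 + ((5 * size w + 1) + (7 * tsz w + 3)))).
  by have := tsz_bits w; lia.
apply: run_seq (run_push _ _ _) _.
have := H (rev w) [::]; rewrite size_rev catrevE revK cats0 => H'.
apply: run_seq H' _.
by have := run_pull (enc w) [::] [::]; rewrite !cats0.
Qed.

Lemma ptime_decides (f : seq bool -> bool) : ptime f ->
  exists M c, forall w, tm_decides_within M w (f w) (c * (size w).+1 ^ c).
Proof.
move=> [cf [c Hc]].
have [k Hk] : polyb (fun n => ((35 * n + 20) + pb c (4 * n + 1)).+2 *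
     (2 * (n + ((35 * n + 20) + pb c (4 * n + 1))) + 2)).
  polyb.
exists (machine (decider (Seq load_input cf))), k => w.
have Hw := Hc w [::] [::]; rewrite !cats0 in Hw.
have [t tle ex] := run_seq (run_load_input w) Hw.
have E : code (enc (f w)) = f w :: behead (code (enc (f w))) by case: (f w).
rewrite E in ex; apply: decider_correct ex _ _.
apply: leq_trans (Hk _).
have {}tle : t <= 35 * size w + 20 + pb c (4 * size w + 1).
  by apply: leq_trans tle _; rewrite leq_add2l pb_mono // tsz_bits.
by rewrite leq_mul ?ltnS // -mul2n leq_add2r leq_mul2l leq_add2l tle.
Qed.

(** * Closure rules and their automation *)

Section Closure.
Variable A : ctype.

Lemma ptime_app1 (B C : ctype) (g : B -> C) (f : A -> B) :
  ptime g -> ptime f -> ptime (fun a => g (f a)).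
Proof. by move=> pg pf; apply: ptime_comp pf pg. Qed.

Lemma ptime_fst1 (B C : ctype) (f : A -> B * C) : ptime f -> ptime (fun a => (f a).1).
Proof. exact/ptime_app1/ptime_fst. Qed.

Lemma ptime_snd1 (B C : ctype) (f : A -> B * C) : ptime f -> ptime (fun a => (f a).2).
Proof. exact/ptime_app1/ptime_snd. Qed.

End Closure.

Ltac ptime_core := match goal with
  | H : ptime _ |- _ => exact: H
  | |- ptime (fun x => x) => exact: ptime_id
  | |- ptime fst => exact: ptime_fst
  | |- ptime snd => exact: ptime_snd
  | |- ptime (fun=> _) => exact: ptime_const
  | |- ptime (fun a => fst (@?f a)) => apply: (@ptime_fst1 _ _ _ f)
  | |- ptime (fun a => snd (@?f a)) => apply: (@ptime_snd1 _ _ _ f)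
  | |- ptime (fun a => (_, _)) => apply: ptime_pair
  | |- ptime (fun a => _ :: _) => apply: ptime_cons
  | |- ptime (fun a => if _ then _ else _) => apply: ptime_if
  end.

(** Hooks that are redefined below, so that [ptime] learns new rules as they are proved. *)
Ltac ptime_lib := fail.
Ltac ptime_alg := fail.
Ltac ptime := repeat first [ptime_core | ptime_lib | ptime_alg].

Section SeqClosure.
Variables (A X Y : ctype).

Lemma ptime_andb (f g : A -> bool) : ptime f -> ptime g -> ptime (fun a => f a && g a).
Proof. by move=> pf pg; apply: (ptime_if pf pg); ptime. Qed.

Lemma ptime_orb (f g : A -> bool) : ptime f -> ptime g -> ptime (fun a => f a || g a).
Proof. by move=> pf pg; apply: (ptime_if pf _ pg); ptime. Qed.

Lemma ptime_negb (f : A -> bool) : ptime f -> ptime (fun a => ~~ f a).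
Proof. by move=> pf; apply: (ptime_if pf); ptime. Qed.

Lemma ptime_addb (f g : A -> bool) : ptime f -> ptime g -> ptime (fun a => f a (+) g a).
Proof.
move=> pf pg; apply: eq_ptime (ptime_if pf (ptime_negb pg) pg) => a.
by case: (f a).
Qed.

Lemma ptime_behead (l : A -> seq X) : ptime l -> ptime (fun a => behead (l a)).
Proof.
move=> pl; apply: (@eq_ptime _ _ (fun a => if l a is x :: l' then l' else [::])).
  by move=> a; case: (l a).
by apply: ptime_case => //; ptime.
Qed.

Lemma ptime_head (x0 : A -> X) (l : A -> seq X) :
  ptime x0 -> ptime l -> ptime (fun a => head (x0 a) (l a)).
Proof.
move=> px pl; apply: (@eq_ptime _ _ (fun a => if l a is x :: l' then x else x0 a)).
  by move=> a; case: (l a).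
by apply: ptime_case => //; ptime.
Qed.

Lemma tsz_catrev (l l' : seq X) : tsz (catrev l l') = tsz l + tsz l' - 1.
Proof.
elim: l l' => [|x l IH] l' /=; first by rewrite tsz_nil; lia.
by rewrite IH !tsz_cons; have := tsz_gt0 l; lia.
Qed.

Lemma tsz_rev (l : seq X) : tsz (rev l) = tsz l.
Proof. by rewrite tsz_catrev tsz_nil; lia. Qed.

Lemma foldl_cons (l l' : seq X) : foldl (fun acc x => x :: acc) l' l = catrev l l'.
Proof. by elim: l l' => //= x l IH l'; rewrite IH. Qed.

Lemma ptime_rev (l : A -> seq X) : ptime l -> ptime (fun a => rev (l a)).
Proof.
move=> pl; apply: (@eq_ptime _ _ (fun a => foldl (fun acc x => x :: acc) [::] (l a))).
  by move=> a; rewrite foldl_cons.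
apply: (@ptime_foldl_inv _ _ _ (fun _ _ => True) l (fun=> [::])
  (fun _ acc x => x :: acc)) => //; ptime.
have [L HL] := ptime_size pl; have [c Hc] : polyb (fun n => (pb L n).+1) by polyb.
exists c => a y x _ le; split=> //; rewrite tsz_cons.
by have := Hc (tsz a); have := HL a; lia.
Qed.

Lemma ptime_foldr_inv (Inv : A -> Y -> Prop)
    (l : A -> seq X) (y0 : A -> Y) (F : A -> X -> Y -> Y) :
  ptime l -> ptime y0 -> ptime (fun z : A * Y * X => F z.1.1 z.2 z.1.2) ->
  (forall a, Inv a (y0 a)) ->
  (exists c, forall a y x, Inv a y -> tsz x <= tsz (l a) ->
     Inv a (F a x y) /\ tsz (F a x y) <= tsz y + pb c (tsz a)) ->
  ptime (fun a => foldr (F a) (y0 a) (l a)).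
Proof.
move=> pl py pF I0 [c Hc].
apply: (@eq_ptime _ _ (fun a => foldl (fun y x => F a x y) (y0 a) (rev (l a)))).
  by move=> a; rewrite foldl_rev.
apply: (@ptime_foldl_inv _ _ _ Inv (fun a => rev (l a)) y0 (fun a y x => F a x y)) => //.
  exact: ptime_rev.
by exists c => a y x; rewrite tsz_rev; apply: Hc.
Qed.

Lemma ptime_foldr_bound (l : A -> seq X) (y0 : A -> Y) (F : A -> X -> Y -> Y) :
  ptime l -> ptime y0 -> ptime (fun z : A * Y * X => F z.1.1 z.2 z.1.2) ->
  (exists c, forall a y x, tsz (F a x y) <= pb c (tsz a)) ->
  ptime (fun a => foldr (F a) (y0 a) (l a)).
Proof.
move=> pl py pF [c Hc]; apply: (@ptime_foldr_inv (fun _ _ => True)) => //.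
by exists c => a y x _ _; split=> //; apply: leq_trans (Hc a y x) _; apply: leq_addl.
Qed.

End SeqClosure.

Lemma ptime_cat (A X : ctype) (l l' : A -> seq X) :
  ptime l -> ptime l' -> ptime (fun a => l a ++ l' a).
Proof.
move=> pl pl'; apply: (@eq_ptime _ _ (fun a => foldr cons (l' a) (l a))).
  by move=> a; elim: (l a) => //= x s ->.
apply: (@ptime_foldr_inv _ _ _ (fun _ _ => True) l l' (fun _ x y => x :: y)) => //; ptime.
have [L HL] := ptime_size pl; have [c Hc] : polyb (fun n => (pb L n).+1) by polyb.
exists c => a y x _ le; split=> //; rewrite tsz_cons.
by have := Hc (tsz a); have := HL a; lia.
Qed.

Lemma ptime_map (A X Y : ctype) (h : A -> X -> Y) (l : A -> seq X) :
  ptime (fun z : A * X => h z.1 z.2) -> ptime l -> ptime (fun a => map (h a) (l a)).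
Proof.
move=> ph pl; apply: (@eq_ptime _ _ (fun a => foldr (fun x y => h a x :: y) [::] (l a))).
  by move=> a; elim: (l a) => //= x s ->.
apply: (@ptime_foldr_inv _ _ _ (fun _ _ => True) l (fun=> [::])
  (fun a x y => h a x :: y)) => //; ptime.
  by apply: (ptime_comp (f := fun z => (z.1.1, z.2)) _ ph); ptime.
have [L HL] := ptime_size pl; have [k Hk] := ptime_size ph.
have [c Hc] : polyb (fun n => (pb k (n + pb L n).+1).+1) by polyb.
exists c => a y x _ le; split=> //; rewrite tsz_cons.
apply: leq_trans (_ : tsz y + (tsz (h a x)).+1 <= _); first by lia.
rewrite leq_add2l; apply: leq_trans (Hc _); rewrite ltnS.
apply: leq_trans (Hk (a, x)) _; apply: pb_mono; rewrite tsz_pair ltnS leq_add2l.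
exact: leq_trans (HL a).
Qed.

Lemma ptime_zip (A X Y : ctype) (l : A -> seq X) (l' : A -> seq Y) :
  ptime l -> ptime l' -> ptime (fun a => zip (l a) (l' a)).
Proof.
move=> pl pl'.
pose F (_ : A) (st : seq Y * seq (X * Y)) (x : X) :=
  if st.1 is y :: ys then (ys, (x, y) :: st.2) else st.
apply: (@eq_ptime _ _ (fun a => rev (foldl (F a) (l' a, [::]) (l a)).2)).
  move=> a; rewrite -[RHS]revK; congr rev.
  rewrite -[rev (zip _ _)]/(catrev _ [::]).
  elim: (l a) (l' a) [::] => [|x s IH] [|y s'] acc //=; last exact: IH.
  by have := IH [::] acc; case: (s).
apply: ptime_rev; apply: ptime_snd1.
apply: (@ptime_foldl_inv _ _ _ (fun a st => tsz st.1 <= tsz (l' a)) l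
         (fun a => (l' a, [::])) F) => //; ptime.
  by apply: (@ptime_case _ _ _ (fun z : A * (seq Y * seq (X * Y)) * X => z.1.2.1)
    (fun z => z.1.2) (fun z y ys => (ys, (z.2, y) :: z.1.2.2))); ptime.
have [L HL] := ptime_size pl; have [k Hk] := ptime_size pl'.
have [c Hc] : polyb (fun n => pb L n + pb k n + 2) by polyb.
exists c => a [[|y ys] out] x /= le1 le2; first by split=> //; apply: leq_addr.
move: le1; rewrite !tsz_pair /= !tsz_cons !tsz_pair /= => le1; split; first lia.
by have := Hc (tsz a); have := HL a; have := Hk a; lia.
Qed.

Lemma ptime_last (A X : ctype) (x0 : A -> X) (l : A -> seq X) :
  ptime x0 -> ptime l -> ptime (fun a => last (x0 a) (l a)).
Proof.
move=> px pl; apply: (@eq_ptime _ _ (fun a => head (x0 a) (rev (l a)))).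
  by move=> a; case: (lastP (l a)) => //= s x; rewrite rev_rcons last_rcons.
by apply: ptime_head => //; apply: ptime_rev.
Qed.

Lemma tsz_bool (b : bool) : tsz b <= 3. Proof. by case: b. Qed.

Lemma ptime_all (A X : ctype) (h : A -> X -> bool) (l : A -> seq X) :
  ptime (fun z : A * X => h z.1 z.2) -> ptime l -> ptime (fun a => all (h a) (l a)).
Proof.
move=> ph pl; apply: (@eq_ptime _ _ (fun a => foldr (fun x b => h a x && b) true (l a))).
  by move=> a; elim: (l a) => //= x s ->.
apply: (@ptime_foldr_bound _ _ _ l (fun=> true) (fun a x b => h a x && b)) => //; ptime.
  apply: ptime_andb; last by ptime.
  by apply: (ptime_comp (f := fun z => (z.1.1, z.2)) _ ph); ptime.
by have [c Hc] := polyb_const 3; exists c => a y x; apply: leq_trans (tsz_bool _) (Hc _).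
Qed.

(* Lists serve as unary numbers. *)
Definition takec X Y (c : seq X) (l : seq Y) := [seq z.2 | z <- zip c l].
Definition dropc X Y (c : seq X) (l : seq Y) := foldl (fun s _ => behead s) l c.

Lemma takecE X Y (c : seq X) (l : seq Y) : takec c l = take (size c) l.
Proof. by elim: c l => [|x c IH] [|y l] //=; rewrite /takec /= -IH. Qed.

Lemma dropcE X Y (c : seq X) (l : seq Y) : dropc c l = drop (size c) l.
Proof.
elim: c l => [|x c IH] l; first by rewrite drop0.
by rewrite [LHS]IH; case: l.
Qed.

Lemma ptime_takec (A X Y : ctype) (c : A -> seq X) (l : A -> seq Y) :
  ptime c -> ptime l -> ptime (fun a => takec (c a) (l a)).
Proof. by move=> pc pl; apply: ptime_map; [ptime | apply: ptime_zip]. Qed.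

Lemma tsz_behead (X : ctype) (l : seq X) : tsz (behead l) <= tsz l.
Proof. by case: l => //= x l; rewrite tsz_cons; lia. Qed.

Lemma ptime_dropc (A X Y : ctype) (c : A -> seq X) (l : A -> seq Y) :
  ptime c -> ptime l -> ptime (fun a => dropc (c a) (l a)).
Proof.
move=> pc pl; apply: (@ptime_foldl_inv _ _ _ (fun _ _ => True) c l
  (fun _ s _ => behead s)) => //; first by apply: ptime_behead; ptime.
by exists 0 => a y x _ _; split=> //; rewrite (leq_trans (tsz_behead y)) ?leq_addr.
Qed.

Ltac ptime_lib ::= match goal with
  | |- ptime (fun a => _ && _) => apply: ptime_andb
  | |- ptime (fun a => _ || _) => apply: ptime_orb
  | |- ptime (fun a => ~~ _) => apply: ptime_negb
  | |- ptime (fun a => _ (+) _) => apply: ptime_addb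
  | |- ptime (fun a => behead _) => apply: ptime_behead
  | |- ptime (fun a => head _ _) => apply: ptime_head
  | |- ptime (fun a => last _ _) => apply: ptime_last
  | |- ptime (fun a => rev _) => apply: ptime_rev
  | |- ptime (fun a => _ ++ _) => apply: ptime_cat
  | |- ptime (fun a => map _ _) => apply: ptime_map
  | |- ptime (fun a => zip _ _) => apply: ptime_zip
  | |- ptime (fun a => all _ _) => apply: ptime_all
  | |- ptime (fun a => takec _ _) => apply: ptime_takec
  | |- ptime (fun a => dropc _ _) => apply: ptime_dropc
  end.

(** * The algorithm *)

Definition full_add (st : seq bool * bool) (z : bool * bool) :=
  (z.1 (+) z.2 (+) st.2 :: st.1, (z.1 && z.2) || (st.2 && (z.1 || z.2))).

Definition adder (c : bool) (x y : seq bool) : seq bool * bool :=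
  let r := foldl full_add ([::], c) (zip x y) in (rev r.1, r.2).

(* Residues modulo [p] are bit lists (least significant bit first) of the same
   width as [p]; subtraction of [p] adds its bitwise complement with carry. *)
Definition addm (p x y : seq bool) : seq bool :=
  let s := adder false x y in
  let d := adder true s.1 (map negb p) in
  takec p (if s.2 || d.2 then d.1 else s.1).

Definition zerom (p : seq bool) : seq bool := map (fun=> false) p.

Definition onem (p : seq bool) : seq bool :=
  if p is _ :: p' then true :: zerom p' else [::].

(** Double and add: as the lists start with the least significant bit, [foldr] treats the top bit
    first. [pow] has the same form. *)
Definition mulm (p x y : seq bool) : seq bool :=
  foldr (fun b acc => let d := addm p acc acc in if b then addm p d y else d)
    (zerom p) x.

(** Adding the all-ones word subtracts one modulo the power of two. *)
Definition minus_one (p : seq bool) : seq bool :=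
  (adder false p (map (fun=> true) p)).1.

Section Extension.
Variables (E X : Type).
Variables (add mul : E -> X -> X -> X) (zero one : E -> X).

(* [A[z]/(z^n - sum_i m_i z^i)]: the environment pairs that of [A] with the
   list [m], and elements are lists of [n] coefficients. *)
Definition xadd (e : E * seq X) (x y : seq X) : seq X :=
  takec e.2 [seq add e.1 z.1 z.2 | z <- zip x y].

Definition xscale (e : E * seq X) (c : X) (y : seq X) : seq X := map (mul e.1 c) y.

Definition xzero (e : E * seq X) : seq X := map (fun=> zero e.1) e.2.

Definition xone (e : E * seq X) : seq X :=
  if e.2 is _ :: m then one e.1 :: map (fun=> zero e.1) m else [::].

(** Multiplication by [z]: the coefficient pushed out at the top re-enters through
    [z^n = sum_i m_i z^i]. With it, [xmul] is a Horner scheme. *)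
Definition xshift (e : E * seq X) (x : seq X) : seq X :=
  xadd e (zero e.1 :: x) (xscale e (last (zero e.1) x) e.2).

Definition xmul (e : E * seq X) (x y : seq X) : seq X :=
  foldr (fun c acc => xadd e (xscale e c y) (xshift e acc)) (xzero e) x.

Definition pow (e : E) (x : X) (n : seq bool) : X :=
  foldr (fun b acc => let d := mul e acc acc in if b then mul e d x else d) (one e) n.

End Extension.

(** * Running time of the arithmetic *)

Lemma tsz_carry (b1 b2 b3 : bool) (s : seq bool) : tsz (b1 :: s, b2) <= tsz (s, b3) + 6.
Proof.
rewrite !tsz_pair /= tsz_cons.
by have := tsz_bool b1; have := tsz_bool b2; have := tsz_gt0 b3; lia.
Qed.

Lemma ptime_adder (A : ctype) c (x y : A -> seq bool) :
  ptime x -> ptime y -> ptime (fun a => adder c (x a) (y a)).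
Proof.
move=> px py.
have H : ptime (fun a => foldl full_add ([::], c) (zip (x a) (y a))).
  apply: (@ptime_foldl_inv _ _ _ (fun _ _ => True) (fun a => zip (x a) (y a))
    (fun=> ([::], c)) (fun _ => full_add)) => //; rewrite /full_add; ptime.
  have [k Hk] := polyb_const 6; exists k => a [s b] z _ _; split=> //.
  apply: leq_trans (tsz_carry _ _ b _) _.
  by rewrite leq_add2l.
by rewrite /adder; ptime.
Qed.

Ltac ptime_alg ::= match goal with
  | |- ptime (fun a => adder _ _ _) => apply: ptime_adder
  end.

Lemma ptime_addm (A : ctype) (p x y : A -> seq bool) :
  ptime p -> ptime x -> ptime y -> ptime (fun a => addm (p a) (x a) (y a)).
Proof. by move=> *; rewrite /addm; ptime. Qed.

Lemma ptime_zerom (A : ctype) (p : A -> seq bool) :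
  ptime p -> ptime (fun a => zerom (p a)).
Proof. by move=> *; rewrite /zerom; ptime. Qed.

Lemma ptime_onem (A : ctype) (p : A -> seq bool) :
  ptime p -> ptime (fun a => onem (p a)).
Proof.
move=> pp; rewrite /onem; apply: (@ptime_case _ _ _ p (fun=> [::])
  (fun a b p' => true :: zerom p')) => //; ptime.
by apply: ptime_zerom; ptime.
Qed.

Lemma tsz_fst (A B : ctype) (z : A * B) : tsz z.1 <= tsz z.
Proof. by rewrite tsz_pair; lia. Qed.

Lemma size_snd_tsz (A B : ctype) (z : A * seq B) : size z.2 <= tsz z.
Proof.
by rewrite tsz_pair (leq_trans (ltnW (size_tsz _))) // leqW // leq_addl.
Qed.

(* The size of the result is controlled by the environment alone, whatever the
   operands: this keeps the iterates of a fold small. *)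
Definition ebounded (E X : ctype) (op : E -> X -> X -> X) :=
  exists c, forall e x y, tsz (op e x y) <= pb c (tsz e).

Lemma tsz_seq_le (X : ctype) (l : seq X) n K :
  size l <= n -> foldr (fun x P => tsz x <= K /\ P) True l ->
  tsz l <= n * K.+1 + 1.
Proof.
elim: l n => [|x l IH] n /=; first by rewrite tsz_nil; lia.
case: n => // n len [Kx Kl].
by rewrite tsz_cons; have := IH n len Kl; nia.
Qed.

Lemma tsz_bits_le (l : seq bool) n : size l <= n -> tsz l <= n * 4 + 1.
Proof. by move=> len; have := tsz_bits l; lia. Qed.

Lemma addm_ebounded : ebounded addm.
Proof.
have [c Hc] : polyb (fun n => n * 4 + 1) by polyb.
exists c => p x y; apply: leq_trans (Hc _); apply: tsz_bits_le.
rewrite /addm takecE size_take_min.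
by apply: leq_trans (geq_minl _ _) _; apply/ltnW/size_tsz.
Qed.

Lemma ptime_mulm (A : ctype) (p x y : A -> seq bool) :
  ptime p -> ptime x -> ptime y -> ptime (fun a => mulm (p a) (x a) (y a)).
Proof.
move=> pp px py.
have H : ptime (fun a : seq bool * seq bool * seq bool => mulm a.1.1 a.1.2 a.2).
  rewrite /mulm; apply: (@ptime_foldr_bound _ _ _
    (fun a : seq bool * seq bool * seq bool => a.1.2) (fun a => zerom a.1.1)
    (fun a b acc => if b then addm a.1.1 (addm a.1.1 acc acc) a.2
                    else addm a.1.1 acc acc)); ptime.
  - by apply: ptime_zerom; ptime.
  - by apply: ptime_addm; ptime; apply: ptime_addm; ptime.
  - by apply: ptime_addm; ptime.
  have [c Hc] := addm_ebounded; exists c => a acc b.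
  have le : pb c (tsz a.1.1) <= pb c (tsz a).
    by apply: pb_mono; rewrite (tsz_pair a) (tsz_pair a.1); lia.
  by case: b; apply: leq_trans le; apply: Hc.
by apply: (ptime_app1 (f := fun a => (p a, x a, y a)) H); ptime.
Qed.

Lemma ptime_minus_one (A : ctype) (p : A -> seq bool) :
  ptime p -> ptime (fun a => minus_one (p a)).
Proof. by move=> *; rewrite /minus_one; ptime. Qed.

Section ExtensionPtime.
Variables (E X : ctype).
Variables (add mul : E -> X -> X -> X) (zero one : E -> X).

Definition ptime_op (op : E -> X -> X -> X) :=
  ptime (fun z : E * X * X => op z.1.1 z.1.2 z.2).

Lemma ptime_opE (A : ctype) op (e : A -> E) (x y : A -> X) : ptime_op op ->
  ptime e -> ptime x -> ptime y -> ptime (fun a => op (e a) (x a) (y a)).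
Proof.
by move=> pop pe px py; apply: (ptime_app1 (f := fun a => (e a, x a, y a)) pop); ptime.
Qed.

Hypotheses (padd : ptime_op add) (pmul : ptime_op mul).
Hypotheses (pzero : ptime zero) (pone : ptime one).
Hypotheses (badd : ebounded add).

Lemma ptime_xadd (A : ctype) (e : A -> E * seq X) (x y : A -> seq X) :
  ptime e -> ptime x -> ptime y -> ptime (fun a => xadd add (e a) (x a) (y a)).
Proof.
by move=> pe px py; rewrite /xadd; ptime; apply: (ptime_opE padd); ptime;
  apply: (ptime_app1 pe); ptime.
Qed.

Lemma ptime_xscale (A : ctype) (e : A -> E * seq X) (x : A -> X) (y : A -> seq X) :
  ptime e -> ptime x -> ptime y -> ptime (fun a => xscale mul (e a) (x a) (y a)).
Proof.
by move=> pe px py; rewrite /xscale; ptime; apply: (ptime_opE pmul); ptime;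
  [apply: (ptime_app1 pe) | apply: (ptime_app1 px)]; ptime.
Qed.

Lemma ptime_xzero (A : ctype) (e : A -> E * seq X) :
  ptime e -> ptime (fun a => xzero zero (e a)).
Proof.
move=> pe; rewrite /xzero; ptime.
by apply: (ptime_app1 pzero); ptime; apply: (ptime_app1 pe); ptime.
Qed.

Lemma ptime_xone (A : ctype) (e : A -> E * seq X) :
  ptime e -> ptime (fun a => xone zero one (e a)).
Proof.
move=> pe; rewrite /xone; apply: (@ptime_case _ _ _ (fun a => (e a).2) (fun=> [::])
  (fun a _ m => one (e a).1 :: map (fun=> zero (e a).1) m)); ptime.
  by apply: (ptime_app1 pone); ptime; apply: (ptime_app1 pe); ptime.
by apply: (ptime_app1 pzero); ptime; apply: (ptime_app1 pe); ptime.
Qed.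

Lemma ptime_xshift (A : ctype) (e : A -> E * seq X) (x : A -> seq X) :
  ptime e -> ptime x -> ptime (fun a => xshift add mul zero (e a) (x a)).
Proof.
move=> pe px; rewrite /xshift; apply: ptime_xadd; ptime.
  by apply: (ptime_app1 pzero); ptime.
apply: ptime_xscale; ptime.
by apply: (ptime_app1 pzero); ptime.
Qed.

Lemma tsz_map_le (T : Type) (f : T -> X) l n K : size l <= n ->
  (forall x, tsz (f x) <= K) -> tsz (map f l) <= n * K.+1 + 1.
Proof.
by move=> len H; apply: tsz_seq_le; [rewrite size_map | elim: l {len} => //=].
Qed.

Lemma xadd_ebounded : ebounded (xadd add).
Proof.
have [c Hc] := badd; have [k Hk] : polyb (fun n => n * (pb c n).+1 + 1) by polyb.
exists k => e x y; apply: leq_trans (Hk _).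
rewrite /xadd takecE -map_take; apply: tsz_map_le => [|z].
  by rewrite size_take_min (leq_trans (geq_minl _ _)) // size_snd_tsz.
by apply: leq_trans (Hc _ _ _) _; apply: pb_mono; apply: tsz_fst.
Qed.

(** The outermost operation of a product with nonempty [x] is an addition, whose bound is inherited;
    an empty [x] gives [xzero]. *)
Lemma xmul_ebounded : ebounded (xmul add mul zero).
Proof.
have [c Hc] := xadd_ebounded; have [z Hz] := ptime_size pzero.
have [k Hk] : polyb (fun n => pb c n + (n * (pb z n).+1 + 1)) by polyb.
exists k => e [|a x] y /=; apply: leq_trans (Hk _).
  apply: leq_trans (leq_addl _ _); apply: tsz_map_le => [|_].
    exact: size_snd_tsz.
  by apply: leq_trans (Hz _) _; apply: pb_mono; apply: tsz_fst.
by apply: leq_trans (leq_addr _ _); apply: Hc.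
Qed.

Lemma ptime_xmul : ptime (fun z : (E * seq X) * seq X * seq X =>
  xmul add mul zero z.1.1 z.1.2 z.2).
Proof.
rewrite /xmul; apply: (@ptime_foldr_bound _ _ _
  (fun z : (E * seq X) * seq X * seq X => z.1.2) (fun z => xzero zero z.1.1)
  (fun z c acc => xadd add z.1.1 (xscale mul z.1.1 c z.2)
                    (xshift add mul zero z.1.1 acc))); ptime.
- by apply: ptime_xzero; ptime.
- apply: ptime_xadd; ptime; first by apply: ptime_xscale; ptime.
  by apply: ptime_xshift; ptime.
have [c Hc] := xadd_ebounded; exists c => z acc x.
apply: leq_trans (Hc _ _ _) _; apply: pb_mono.
by rewrite (tsz_pair z) (tsz_pair z.1); lia.
Qed.

Lemma ptime_pow (A : ctype) (e : A -> E) (x : A -> X) (n : A -> seq bool) :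
  ebounded mul -> ptime e -> ptime x -> ptime n ->
  ptime (fun a => pow mul one (e a) (x a) (n a)).
Proof.
move=> [c Hc] pe px pn.
have H : ptime (fun z : E * X * seq bool => pow mul one z.1.1 z.1.2 z.2).
  rewrite /pow; apply: (@ptime_foldr_bound _ _ _ (fun z : E * X * seq bool => z.2)
    (fun z => one z.1.1)
    (fun z b acc => if b then mul z.1.1 (mul z.1.1 acc acc) z.1.2
                    else mul z.1.1 acc acc)); ptime.
  - by apply: (ptime_app1 pone); ptime.
  - by apply: (ptime_opE pmul); ptime; apply: (ptime_opE pmul); ptime.
  - by apply: (ptime_opE pmul); ptime.
  exists c => z acc b.
  have le : pb c (tsz z.1.1) <= pb c (tsz z).
    by apply: pb_mono; rewrite (tsz_pair z) (tsz_pair z.1); lia.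
  by case: b; apply: leq_trans le; apply: Hc.
by apply: (ptime_app1 (f := fun a => (e a, x a, n a)) H); ptime.
Qed.

End ExtensionPtime.

(* Reading from the right, the first component holds the second bit of an
   incomplete pair. *)
Definition parse_step (x : bool) (st : seq bool * seq (seq bool)) :=
  if st.1 is b :: _ then
    ([::], if x then (if st.2 is h :: t then (b :: h) :: t else [::])
           else [::] :: st.2)
  else ([:: x], st.2).

Definition parse_nats (w : seq bool) : seq (seq bool) :=
  (foldr parse_step ([::], [::]) w).2.

(** Truncation to the length of [clock] is what keeps this polynomial: on an arbitrary input the
    binary number may be exponentially larger than its code. *)
Definition unary X (clock : seq X) (n : seq bool) : seq bool :=
  foldr (fun b acc => takec clock ((if b then [:: true] else [::]) ++ acc ++ acc))
    [::] n.

Definition chunk_step X (s : seq bool) (st : seq X * seq (seq X)) :=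
  if st.1 is x :: l then (dropc s (x :: l), takec s (x :: l) :: st.2) else st.

(** The list serves as its own fuel. The blocks come out in reverse order, which does not affect the
    sum formed from them. *)
Definition chunks X (s : seq bool) (l : seq X) : seq (seq X) :=
  (foldl (fun st _ => chunk_step s st) (l, [::]) l).2.

(** The tower: unsuffixed operations work in [F_p], suffix 2 in [F_p[xi]/<phi>], where [m] lists the
    coefficients of [xi^s - phi], and suffix 3 in [F_q[T]/(T^N)], where [m] is a list of [N]
    zeros. *)
Notation add2 := (xadd addm).
Notation mul2 := (xmul addm mulm zerom).
Notation zero2 := (xzero zerom).
Notation one2 := (xone zerom onem).
Notation env2 := (seq bool * seq (seq bool))%type.
Notation elt2 := (seq (seq bool)).

Notation add3 := (xadd add2).
Notation mul3 := (xmul add2 mul2 zero2).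
Notation zero3 := (xzero zero2).
Notation one3 := (xone zero2 one2).
Notation env3 := (env2 * seq elt2)%type.
Notation elt3 := (seq elt2).

(* The list [e.2] of an [env3] consists of zeros, so it also pads. *)
Definition const3 (e : env3) (c : elt2) : elt3 := c :: behead e.2.
Definition linear3 (e : env3) (c d : elt2) : elt3 := c :: d :: behead (behead e.2).

Definition term3 (e : env3) (x l : elt3) (s : seq bool) (ch : seq (seq bool)) : elt3 :=
  mul3 e (const3 e (takec s ch))
    (mul3 e (pow mul3 one3 e x (head [::] (dropc s ch)))
            (pow mul3 one3 e l (head [::] (behead (dropc s ch))))).

Definition total3 (e : env3) (x l : elt3) (s : seq bool) (chs : seq (seq (seq bool))) : elt3 :=
  foldr (fun ch acc => add3 e (term3 e x l s ch) acc) (zero3 e) chs.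

(** Evaluates [P] at [X = rho + T] modulo [T^N]; the second linear form is [u (rho + T) + v]. *)
Definition check (e : env3) (u v : elt2) (s : seq bool)
    (chs : seq (seq (seq bool))) (rho : elt2) : bool :=
  all (all (all negb))
    (total3 e (linear3 e rho (one2 e.1)) (linear3 e (add2 e.1 (mul2 e.1 u rho) v) u) s chs).

Definition fit (p x : seq bool) : seq bool := takec p (x ++ zerom p).

(** Fixes [N] as the squared length of [L] plus 2. With [L] the list of all input numbers, longer
    than [k], this dominates [k^2 + k]; the added 2 gives [linear3] its two slots at once. *)
Definition pad3 X (L : seq X) (z : elt2) : elt3 :=
  foldr (fun _ acc => map (fun=> z) L ++ acc) [:: z; z] L.

Definition decide_fields (L : seq (seq bool)) (e : env2) (s : seq bool)
    (u v : elt2) (rest : seq (seq bool)) : bool :=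
  (* A block is a term: [s] coefficients of [a j], then the two exponents. *)
  check (e, pad3 L (zero2 e)) u v s (chunks (true :: true :: s) rest) (one2 e) &&
  check (e, pad3 L (zero2 e)) u v s (chunks (true :: true :: s) rest)
    (add2 e (one2 e) (one2 e)).

(** The first [behead] skips the leading coefficient 1 of [phi], the second one the entry [k]: the
    number of terms is recovered from the length of what remains. *)
Definition decide_data (L : seq (seq bool)) (p s : seq bool) (D : seq (seq bool)) : bool :=
  let D1 := behead (dropc s D) in
  let D2 := dropc s D1 in
  decide_fields L (p, map (mulm p (minus_one p)) (takec s D)) s
    (takec s D1) (takec s D2) (behead (dropc s D2)).

(** On an instance the exponents are below [p] like the coefficients, so the width of [p] suits
    both. *)
Definition decide_nats (L : seq (seq bool)) : bool :=
  decide_data L (head [::] L) (unary L (head [::] (behead L)))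
    (map (fit (head [::] L)) (behead (behead L))).

Definition decide (w : seq bool) : bool := decide_nats (parse_nats w).

(** * Running time of the decision procedure *)

Lemma ptime_parse_nats : ptime parse_nats.
Proof.
apply: ptime_snd1.
apply: (@ptime_foldr_inv _ _ _
  (fun _ (st : seq bool * seq (seq bool)) => size st.1 <= 1)
  (fun w : seq bool => w) (fun=> ([::], [::])) (fun _ => parse_step)) => //; ptime.
  rewrite /parse_step.
  apply: (@ptime_case _ _ _ (fun z : seq bool * (seq bool * seq (seq bool)) * bool => z.1.2.1)
    (fun z => ([:: z.2], z.1.2.2)) (fun z b _ => ([::], if z.2 then
      (if z.1.2.2 is h :: t then (b :: h) :: t else [::]) else [::] :: z.1.2.2))); ptime.
  by apply: (@ptime_case _ _ _
     (fun z : seq bool * (seq bool * seq (seq bool)) * bool * bool * seq bool => z.1.1.1.2.2)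
     (fun=> [::]) (fun z h t => (z.1.2 :: h) :: t)); ptime.
have [c Hc] := polyb_const 10; exists c => a [o out] x /= leo _.
suff H : size (parse_step x (o, out)).1 <= 1 /\
    tsz (parse_step x (o, out)) <= tsz (o, out) + 10.
  by case: H => H1 H2; split=> //; apply: leq_trans H2 _; rewrite leq_add2l.
case: o leo => [|b [|//]] _; split=> //; rewrite /parse_step /=.
  rewrite !tsz_pair /= tsz_cons !tsz_nil; have := tsz_bool x; lia.
rewrite !tsz_pair /= !tsz_cons !tsz_nil; case: x; last by rewrite tsz_cons tsz_nil; lia.
by case: out => [|h t]; rewrite ?tsz_cons ?tsz_nil; lia.
Qed.

Lemma ptime_unary (A X : ctype) (c : A -> seq X) (n : A -> seq bool) :
  ptime c -> ptime n -> ptime (fun a => unary (c a) (n a)).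
Proof.
move=> pc pn; have [k Hk] := ptime_size pc.
apply: (@ptime_foldr_bound _ _ _ n (fun=> [::])
  (fun a b acc => takec (c a) ((if b then [:: true] else [::]) ++ acc ++ acc))) => //; ptime.
  by apply: (ptime_app1 pc); ptime.
have [d Hd] : polyb (fun n => pb k n * 4 + 1) by polyb.
exists d => a y x; apply: leq_trans (Hd _); apply: tsz_bits_le.
rewrite takecE size_take_min; apply: leq_trans (geq_minl _ _) _.
exact: leq_trans (ltnW (size_tsz _)) (Hk _).
Qed.

Lemma tsz_take (X : ctype) n (l : seq X) : tsz (take n l) <= tsz l.
Proof.
elim: l n => [|x l IH] [|n] //=.
by rewrite !tsz_cons ltnS leq_add2l.
Qed.

Lemma tsz_drop (X : ctype) n (l : seq X) : tsz (drop n l) <= tsz l.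
Proof.
by elim: l n => [|x l IH] [|n] //=; apply: leq_trans (IH n) _; rewrite tsz_cons; lia.
Qed.

Lemma ptime_chunks (A X : ctype) (s : A -> seq bool) (l : A -> seq X) :
  ptime s -> ptime l -> ptime (fun a => chunks (s a) (l a)).
Proof.
move=> ps pl; apply: ptime_snd1; have [k Hk] := ptime_size pl.
apply: (@ptime_foldl_inv _ _ _ (fun a (st : seq X * seq (seq X)) => tsz st.1 <= tsz (l a))
  l (fun a => (l a, [::])) (fun a st _ => chunk_step (s a) st)) => //; ptime.
  rewrite /chunk_step; apply: (@ptime_case _ _ _
    (fun z : A * (seq X * seq (seq X)) * X => z.1.2.1) (fun z => z.1.2)
    (fun z x l' => (dropc (s z.1.1) (x :: l'), takec (s z.1.1) (x :: l') :: z.1.2.2))); ptime;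
  by apply: (ptime_app1 ps); ptime.
have [c Hc] : polyb (fun n => pb k n + 1) by polyb.
(* A step moves a prefix of the remaining list to the output, so it adds at most the size of the
   original list and one list node. *)
exists c => a [[|x l'] out] y le1 _; first by rewrite leq_addr.
have -> : chunk_step (s a) (x :: l', out) =
    (drop (size (s a)) (x :: l'), take (size (s a)) (x :: l') :: out).
  by rewrite -dropcE -takecE.
have le2 := tsz_drop (size (s a)) (x :: l').
split; first exact: leq_trans le2 le1.
have le3 := tsz_take (size (s a)) (x :: l').
rewrite !tsz_pair [_.1]/= [_.2]/= (tsz_cons (take _ _)).
move: le1 le2 le3 (Hc (tsz a)) (Hk a) => /=; set T := tsz (x :: l'); lia.
Qed.

Lemma ptime_fit (A : ctype) (p x : A -> seq bool) :
  ptime p -> ptime x -> ptime (fun a => fit (p a) (x a)).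
Proof. by move=> pp px; rewrite /fit; ptime; apply: ptime_zerom. Qed.

Lemma ptime_pad3 (A X : ctype) (L : A -> seq X) (z : A -> elt2) :
  ptime L -> ptime z -> ptime (fun a => pad3 (L a) (z a)).
Proof.
move=> pL pz; have pm : ptime (fun a => map (fun=> z a) (L a)).
  by ptime; apply: (ptime_app1 pz); ptime.
have [k Hk] := ptime_size pm.
apply: (@ptime_foldr_inv _ _ _ (fun _ _ => True) L (fun a => [:: z a; z a])
  (fun a _ acc => map (fun=> z a) (L a) ++ acc)) => //; ptime.
- by apply: (ptime_app1 pz); ptime.
- by apply: (ptime_app1 pL); ptime.
exists k => a y x _ _; split=> //; rewrite addnC.
apply: leq_trans (_ : tsz (map (fun=> z a) (L a)) + tsz y <= _).
  elim: (map _ _) => [|x' s IH]; rewrite ?cat0s ?leq_addl //.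
  by rewrite cat_cons !tsz_cons addSn ltnS -addnA leq_add2l.
by rewrite leq_add2r.
Qed.

Lemma ptime_addm_op : ptime_op addm. Proof. by apply: ptime_addm; ptime. Qed.
Lemma ptime_mulm_op : ptime_op mulm. Proof. by apply: ptime_mulm; ptime. Qed.
Lemma ptime_zerom_id : ptime zerom. Proof. by apply: ptime_zerom; ptime. Qed.
Lemma ptime_onem_id : ptime onem. Proof. by apply: ptime_onem; ptime. Qed.

Lemma ptime_add2_op : @ptime_op (seq bool * elt2)%type (seq (seq bool)) add2.
Proof. by apply: (ptime_xadd ptime_addm_op); ptime. Qed.
Lemma ptime_mul2_op : @ptime_op (seq bool * elt2)%type (seq (seq bool)) mul2.
Proof.
exact: (ptime_xmul ptime_addm_op ptime_mulm_op ptime_zerom_id addm_ebounded).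
Qed.
Lemma ptime_zero2_id : @ptime (seq bool * elt2)%type (seq (seq bool)) zero2.
Proof. by apply: (ptime_xzero ptime_zerom_id); ptime. Qed.
Lemma ptime_one2_id : @ptime (seq bool * elt2)%type (seq (seq bool)) one2.
Proof. by apply: (ptime_xone ptime_zerom_id ptime_onem_id); ptime. Qed.
Lemma add2_ebounded : @ebounded (seq bool * elt2)%type (seq (seq bool)) add2.
Proof. exact: xadd_ebounded addm_ebounded. Qed.

Lemma ptime_add3_op : @ptime_op env3 elt3 add3.
Proof. by apply: (ptime_xadd ptime_add2_op); ptime. Qed.
Lemma ptime_mul3_op : @ptime_op env3 elt3 mul3.
Proof.
exact: (ptime_xmul ptime_add2_op ptime_mul2_op ptime_zero2_id add2_ebounded).
Qed.
Lemma ptime_zero3_id : @ptime env3 elt3 zero3.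
Proof. by apply: (ptime_xzero ptime_zero2_id); ptime. Qed.
Lemma ptime_one3_id : @ptime env3 elt3 one3.
Proof. by apply: (ptime_xone ptime_zero2_id ptime_one2_id); ptime. Qed.
Lemma add3_ebounded : @ebounded env3 elt3 add3.
Proof. exact: xadd_ebounded add2_ebounded. Qed.
Lemma mul3_ebounded : @ebounded env3 elt3 mul3.
Proof. exact: (xmul_ebounded _ ptime_zero2_id add2_ebounded). Qed.

Ltac ptime_alg ::= match goal with
  | |- ptime (fun a => add2 _ _ _) => apply: (ptime_opE ptime_add2_op)
  | |- ptime (fun a => mul2 _ _ _) => apply: (ptime_opE ptime_mul2_op)
  | |- ptime (fun a => zero2 _) => apply: (ptime_app1 ptime_zero2_id)
  | |- ptime (fun a => one2 _) => apply: (ptime_app1 ptime_one2_id)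
  | |- ptime (fun a => add3 _ _ _) => apply: (ptime_opE ptime_add3_op)
  | |- ptime (fun a => mul3 _ _ _) => apply: (ptime_opE ptime_mul3_op)
  | |- ptime (fun a => zero3 _) => apply: (ptime_app1 ptime_zero3_id)
  | |- ptime (fun a => pow _ _ _ _ _) =>
      apply: (ptime_pow ptime_mul3_op ptime_one3_id mul3_ebounded)
  | |- ptime (fun a => unary _ _) => apply: ptime_unary
  | |- ptime (fun a => chunks _ _) => apply: ptime_chunks
  | |- ptime (fun a => fit _ _) => apply: ptime_fit
  | |- ptime (fun a => pad3 _ _) => apply: ptime_pad3
  | |- ptime (fun a => mulm _ _ _) => apply: ptime_mulm
  | |- ptime (fun a => minus_one _) => apply: ptime_minus_one
  end.

Lemma ptime_term3 : ptime (fun z : env3 * elt3 * elt3 * seq bool * seq (seq bool) =>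
  term3 z.1.1.1.1 z.1.1.1.2 z.1.1.2 z.1.2 z.2).
Proof. by rewrite /term3 /const3; ptime. Qed.

Lemma ptime_total3 : ptime (fun z : env3 * elt3 * elt3 * seq bool * seq (seq (seq bool)) =>
  total3 z.1.1.1.1 z.1.1.1.2 z.1.1.2 z.1.2 z.2).
Proof.
rewrite /total3; apply: (@ptime_foldr_bound _ _ _
  (fun z : env3 * elt3 * elt3 * seq bool * seq (seq (seq bool)) => z.2)
  (fun z => zero3 z.1.1.1.1)
  (fun z ch acc => add3 z.1.1.1.1 (term3 z.1.1.1.1 z.1.1.1.2 z.1.1.2 z.1.2 ch) acc)); ptime.
  by apply: (ptime_app1 (f := fun z => (z.1.1.1, z.2)) ptime_term3); ptime.
have [c Hc] := add3_ebounded; exists c => z y x.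
apply: leq_trans (Hc _ _ _) _; apply: pb_mono.
by do 3![apply: leq_trans (tsz_fst _)]; apply: tsz_fst.
Qed.

Lemma ptime_check : ptime (fun z : env3 * elt2 * elt2 * seq bool * seq (seq (seq bool)) * elt2 =>
  check z.1.1.1.1.1 z.1.1.1.1.2 z.1.1.1.2 z.1.1.2 z.1.2 z.2).
Proof.
rewrite /check; ptime.
apply: (ptime_app1 (f := fun z : env3 * elt2 * elt2 * seq bool * seq (seq (seq bool)) * elt2 =>
  (z.1.1.1.1.1, linear3 z.1.1.1.1.1 z.2 (one2 z.1.1.1.1.1.1),
   linear3 z.1.1.1.1.1 (add2 z.1.1.1.1.1.1 (mul2 z.1.1.1.1.1.1 z.1.1.1.1.2 z.2) z.1.1.1.2)
     z.1.1.1.1.2, z.1.1.2, z.1.2)) ptime_total3).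
by rewrite /linear3; ptime.
Qed.

Lemma ptime_decide_fields :
  ptime (fun z : seq (seq bool) * env2 * seq bool * elt2 * elt2 * seq (seq bool) =>
    decide_fields z.1.1.1.1.1 z.1.1.1.1.2 z.1.1.1.2 z.1.1.2 z.1.2 z.2).
Proof.
rewrite /decide_fields; ptime;
  set T := (seq (seq bool) * env2 * seq bool * elt2 * elt2 * seq (seq bool))%type.
  by apply: (ptime_app1 (f := fun z : T =>
    (z.1.1.1.1.2, pad3 z.1.1.1.1.1 (zero2 z.1.1.1.1.2), z.1.1.2, z.1.2, z.1.1.1.2,
     chunks (true :: true :: z.1.1.1.2) z.2, one2 z.1.1.1.1.2)) ptime_check); ptime.
by apply: (ptime_app1 (f := fun z : T =>
    (z.1.1.1.1.2, pad3 z.1.1.1.1.1 (zero2 z.1.1.1.1.2), z.1.1.2, z.1.2, z.1.1.1.2,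
     chunks (true :: true :: z.1.1.1.2) z.2,
     add2 z.1.1.1.1.2 (one2 z.1.1.1.1.2) (one2 z.1.1.1.1.2))) ptime_check); ptime.
Qed.

Lemma ptime_decide_data :
  ptime (fun z : seq (seq bool) * seq bool * seq bool * seq (seq bool) =>
    decide_data z.1.1.1 z.1.1.2 z.1.2 z.2).
Proof.
by apply: (ptime_app1 (f := fun z : seq (seq bool) * seq bool * seq bool * seq (seq bool) =>
  let D1 := behead (dropc z.1.2 z.2) in let D2 := dropc z.1.2 D1 in
  (z.1.1.1, (z.1.1.2, map (mulm z.1.1.2 (minus_one z.1.1.2)) (takec z.1.2 z.2)), z.1.2,
   takec z.1.2 D1, takec z.1.2 D2, behead (dropc z.1.2 D2))) ptime_decide_fields); cbv zeta; ptime.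
Qed.

Lemma ptime_decide : ptime decide.
Proof.
apply: (ptime_comp ptime_parse_nats).
apply: (ptime_app1 (f := fun L : seq (seq bool) =>
  (L, head [::] L, unary L (head [::] (behead L)),
   map (fit (head [::] L)) (behead (behead L)))) ptime_decide_data); ptime.
- by apply: (@ptime_head _ _ (fun=> [::]) (fun L => L)); ptime.
- by apply: (@ptime_behead _ _ (fun L => L)); ptime.
- by apply: (@ptime_behead _ _ (fun L => L)); ptime.
Qed.

(** * Multiplicities of sparse sums *)

Local Open Scope ring_scope.

Section Wronskian.
Variables (F : fieldType) (p : nat).
Hypothesis charp : p \in [pchar F].
Variable B : {poly F}.
Hypothesis Bneq0 : B != 0.

Let p_pr : prime p. Proof. exact: (andP charp).1. Qed.

(** The factor [B] is chosen later so that each summand is mapped to a polynomial multiple of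
    itself. *)
Definition Bderiv (f : {poly F}) : {poly F} := B * f^`().

Lemma BderivM f g : Bderiv (f * g) = Bderiv f * g + f * Bderiv g.
Proof. by rewrite /Bderiv derivM; ring. Qed.

Lemma BderivZ c f : Bderiv (c *: f) = c *: Bderiv f.
Proof. by rewrite /Bderiv derivZ scalerAr. Qed.

Lemma Bderiv_sum (I : finType) (f : I -> {poly F}) :
  Bderiv (\sum_i f i) = \sum_i Bderiv (f i).
Proof. by rewrite /Bderiv raddf_sum mulr_sumr. Qed.

Lemma coef_deriv_eq0 (f : {poly F}) m : f^`() = 0 -> f`_m != 0 -> (p %| m)%N.
Proof.
case: m => // m f'0 fm; rewrite (dvdn_pcharf charp).
have := congr1 (fun g : {poly F} => g`_m) f'0; rewrite coef_deriv coef0 -[f`__ *+ _]mulr_natr.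
by move/eqP; rewrite mulf_eq0 (negbTE fm).
Qed.

Lemma det_kernel (R : idomainType) n (W : 'M[R]_n) (e : 'cV[R]_n) :
  \det W != 0 -> W *m e = 0 -> e = 0.
Proof.
move=> dW We; have : \adj W *m (W *m e) = 0 by rewrite We mulmx0.
rewrite mulmxA mul_adj_mx mul_scalar_mx => /matrixP E.
apply/matrixP => i j; have := E i j; rewrite !mxE => /eqP.
by rewrite mulf_eq0 (negbTE dW) => /eqP.
Qed.

Definition wronskian r (f : 'I_r -> {poly F}) : 'M[{poly F}]_r :=
  \matrix_(i, j) iter i Bderiv (f j).

(* The cofactors [C j] of the last row have ratios with vanishing derivative,
   so [C j * M ^+ p.-1] is a polynomial in ['X^p]; reading the relation one
   block of [p] coefficients at a time gives a relation over [F]. *)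
Lemma wronskian_dependent r (f : 'I_r -> {poly F}) :
  (forall j, size (f j) <= p)%N -> \det (wronskian f) = 0 ->
  exists2 c : 'I_r -> F, exists j, c j != 0 & \sum_j c j *: f j = 0.
Proof.
elim: r f => [|r IH] f szf detW.
  by move/eqP: detW; rewrite det_mx00 oner_eq0.
set W := wronskian f in detW; pose C j := cofactor W ord_max j.
pose f' (j : 'I_r) := f (lift ord_max j).
have ME : C ord_max = \det (wronskian f').
  rewrite /C /cofactor -signr_odd addnn odd_double mul1r; congr (\det _).
  by apply/matrixP => i j; rewrite !mxE lift_max.
(* Expansion along the last row, with row [i] in its place: a repeated row, or [\det W] itself. *)
have rel (i : 'I_r.+1) : \sum_j C j * W i j = 0.
  have E : (W *m \adj W) i ord_max = 0 by rewrite mul_mx_adj detW mxE mul0rn.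
  by rewrite -[RHS]E mxE; apply: eq_bigr => j _; rewrite [\adj W _ _]mxE mulrC.
(* The last cofactor is the Wronskian of the family without its last member; if it vanishes, that
   family is already dependent. *)
have [M0|Mneq0] := eqVneq (C ord_max) 0.
  have [|c [j0 cj0] sumc] := IH f' (fun j => szf _); first by rewrite -ME.
  exists (fun j => if unlift ord_max j is Some j' then c j' else 0).
    by exists (lift ord_max j0); rewrite liftK.
  rewrite (bigD1_ord ord_max) //= unlift_none scale0r add0r -[RHS]sumc.
  by apply: eq_bigr => j _; rewrite liftK.
set M := C ord_max in Mneq0 ME.
(* Applying the derivation to relation [i] gives this sum plus relation [i + 1], because each row is
   the derivative of the one above. *)
have rel' (i : 'I_r) : \sum_j Bderiv (C j) * W (lift ord_max i) j = 0.
  have := congr1 Bderiv (rel (lift ord_max i)).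
  rewrite Bderiv_sum {2}/Bderiv deriv0 mulr0.
  under eq_bigr do rewrite BderivM.
  rewrite big_split /=; set S := (X in _ + X).
  suff -> : S = 0 by rewrite addr0.
  have lti : (i.+1 < r.+1)%N by rewrite ltnS.
  rewrite -(rel (Ordinal lti)); apply: eq_bigr => j _.
  by rewrite !mxE lift_max.
(* This says that [C j / M] has derivative zero. The numerators of these derivatives form a vector
   killed by the nonsingular smaller Wronskian. *)
have CM j : M * (C j)^`() = C j * M^`().
  pose e := \col_(j < r) (M * Bderiv (C (lift ord_max j))
                          - C (lift ord_max j) * Bderiv M).
  have e0 : e = 0.
    apply: (@det_kernel _ _ (wronskian f')); first by rewrite -ME.
    apply/matrixP => i k; rewrite !mxE.
    transitivity (\sum_j (M * Bderiv (C j) - C j * Bderiv M) * W (lift ord_max i) j).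
      rewrite (bigD1_ord ord_max) //= subrr mul0r add0r.
      by apply: eq_bigr => j' _; rewrite !mxE lift_max mulrC.
    transitivity (M * (\sum_j Bderiv (C j) * W (lift ord_max i) j)
                  - Bderiv M * (\sum_j C j * W (lift ord_max i) j)).
      by rewrite !mulr_sumr -sumrB; apply: eq_bigr => j' _; ring.
    by rewrite rel' rel !mulr0 subrr.
  have [j' ->|->] := unliftP ord_max j; last by rewrite mulrC.
  have /matrixP/(_ j' 0) := e0; rewrite !mxE /Bderiv => /eqP.
  rewrite subr_eq0 => /eqP E; apply: (mulfI Bneq0).
  by rewrite mulrCA E mulrCA.
(* This is [(C j / M) * M ^+ p]: the denominator is cleared by a [p]-th power, whose derivative is
   zero. *)
pose c j := C j * M ^+ p.-1.
have c'0 j : (c j)^`() = 0.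
  have [q pE] : exists q, p = q.+2 by case: p p_pr => [|[|q]] // _; exists q.
  have p0 : (M ^+ q * (C j * M^`())) *+ p = 0.
    by rewrite -mulr_natr -polyC_natr (pcharf0 charp) polyC0 mulr0.
  rewrite /c derivM deriv_exp pE /= -[RHS]p0 pE.
  rewrite (_ : (C j)^`() * M ^+ q.+1 = M ^+ q * (C j * M^`())); last first.
    by rewrite -CM exprS; ring.
  by rewrite [RHS]mulrS; congr (_ + _); rewrite mulrnAr; congr (_ *+ _); ring.
have sumc : \sum_j c j * f j = 0.
  rewrite /c; under eq_bigr do rewrite mulrAC.
  rewrite -mulr_suml (_ : \sum_j C j * f j = 0) ?mul0r // -[RHS](rel ord0).
  by apply: eq_bigr => j _; rewrite !mxE.
have cmax : c ord_max != 0 by rewrite mulf_neq0 // expf_neq0.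
(* Any index with a nonzero coefficient of some [c j] would do; the degree of [c ord_max] is one. *)
pose e0 := (size (c ord_max)).-1.
have ce0 : (c ord_max)`_e0 != 0 by rewrite -[_`_e0]/(lead_coef _) lead_coef_eq0.
have pe0 : (p %| e0)%N := coef_deriv_eq0 (c'0 _) ce0.
exists (fun j => (c j)`_e0); first by exists ord_max.
apply/polyP => d; rewrite coef_sum coef0.
have [led|ltd] := leqP p d.
  by apply: big1 => j _; rewrite coefZ (nth_default _ (leq_trans (szf j) led)) mulr0.
(* The other multiples of [p] up to [e0 + d] are at most [e0 - p], since [d < p]; they would pair
   with coefficients of [f j] of index at least [p], which vanish. *)
transitivity ((\sum_j c j * f j)`_(e0 + d)%N); last by rewrite sumc coef0.
rewrite coef_sum; apply: eq_bigr => j _; rewrite coefZ [RHS]coefM.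
have lte : (e0 < (e0 + d).+1)%N by rewrite ltnS leq_addr.
rewrite (bigD1 (Ordinal lte)) //= addKn big1 ?addr0 // => i ne.
have [->|nz] := eqVneq (c j)`_i 0; first by rewrite mul0r.
have [k iE] := dvdnP (coef_deriv_eq0 (c'0 _) nz).
have [l eE] := dvdnP pe0.
rewrite (nth_default _ (leq_trans (szf j) _)) ?mulr0 //.
have {}ne : (i : nat) != e0 by [].
have lei := ltn_ord i; have p_gt0 := prime_gt0 p_pr.
have : (k < l.+1)%N by rewrite -(ltn_pmul2r p_gt0) mulSn -iE -eE; lia.
rewrite ltnS leq_eqVlt => /orP[/eqP kl|]; first by rewrite iE eE kl eqxx in ne.
rewrite -(leq_pmul2r p_gt0) mulSn -iE -eE; lia.
Qed.

End Wronskian.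

Lemma det_scale_cols (R : comNzRingType) n (H : 'M[R]_n) (f : 'I_n -> R) :
  \det (\matrix_(i, j) (H i j * f j)) = \det H * \prod_j f j.
Proof.
rewrite -[\prod_j f j](_ : \det (diag_mx (\row_j f j)) = _); last first.
  by rewrite det_diag; apply: eq_bigr => j _; rewrite mxE.
rewrite -det_mulmx; congr (\det _); apply/matrixP => i j.
by rewrite mul_mx_diag !mxE.
Qed.

(** Row [i] has entries of degree at most [i], so each of the [n] factors of a product has size at
    most [n]. This count is the source of the square in the multiplicity bound. *)
Lemma size_det_le (R : idomainType) n (H : 'M[{poly R}]_n) :
  (forall i j, size (H i j) <= i.+1)%N -> (size (\det H) <= (n * n).+1)%N.
Proof.
move=> szH; rewrite /determinant; apply: (leq_trans (size_sum _ _ _)); apply/bigmax_leqP => s _.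
rewrite size_Msign.
have [nz|] := boolP [forall i, H i (s i) != 0]; last first.
  rewrite negb_forall => /existsP[i]; rewrite negbK => /eqP Hi.
  by rewrite (bigD1 i) //= Hi mul0r size_poly0.
rewrite size_prod => [|i _]; last exact: (forallP nz).
have : (\sum_(i < n) size (H i (s i)) <= \sum_(i < n) n)%N.
  by apply: leq_sum => i _; apply: leq_trans (szH _ _) (ltn_ord i).
rewrite sum_nat_const card_ord => le.
by apply: leq_trans (leq_subr _ _) _; rewrite ltnS.
Qed.

Section Multiplicity.
Variables (F : fieldType) (p : nat).
Hypothesis charp : p \in [pchar F].
Variables (B : {poly F}) (rho : F).
Hypotheses (Bneq0 : B != 0) (szB : (size B <= 3)%N).

Let T := 'X - rho%:P.

Lemma dvdp_Bderiv n (f : {poly F}) : (T ^+ n.+1 %| f) -> (T ^+ n %| Bderiv B f).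
Proof.
case/dvdpP=> g ->; rewrite /Bderiv derivM deriv_exp /=.
rewrite dvdp_mull // dvdp_add //; first by rewrite exprS mulrA dvdp_mulIr.
by rewrite dvdp_mull // -mulr_natr dvdp_mulr // dvdp_mull.
Qed.

Lemma dvdp_iter_Bderiv i n (f : {poly F}) :
  (T ^+ (n + i) %| f) -> (T ^+ n %| iter i (Bderiv B) f).
Proof.
elim: i n => [|i IH] n; first by rewrite addn0.
by rewrite addnS -addSn => /IH /dvdp_Bderiv.
Qed.

(* If [h] is nonsingular, its adjugate isolates each [a j *: f j]; if not, the
   Wronskian vanishes and some [f j0] is eliminated. *)
Lemma multiplicity_bound r (f q : 'I_r -> {poly F}) (a : 'I_r -> F) N :
  (forall j, Bderiv B (f j) = q j * f j) ->
  (forall j, size (q j) <= 2)%N -> (forall j, size (f j) <= p)%N ->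
  (forall j, (f j).[rho] != 0) -> (r * r + r <= N)%N ->
  T ^+ N %| \sum_j a j *: f j -> \sum_j a j *: f j = 0.
Proof.
elim: r f q a => [|r IH] f q a Df szq szf frho leN TP; first by rewrite big_ord0.
(* The recursion is [D (g f_j) = (D g + q_j g) f_j]. *)
pose h i j := iter i (fun g => Bderiv B g + q j * g) 1.
have hS i j : h i.+1 j = Bderiv B (h i j) + q j * h i j by [].
have hE i j : iter i (Bderiv B) (f j) = h i j * f j.
  elim: i => [|i IHi]; first by rewrite mul1r.
  by rewrite iterS IHi BderivM Df hS; ring.
(* Each step raises the degree by at most one: [B] has degree at most 2 but the derivative loses
   one, and [q j] has degree at most 1. *)
have szh i j : (size (h i j) <= i.+1)%N.
  elim: i => [|i IHi]; first by rewrite size_poly1.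
  rewrite hS; apply: leq_trans (size_polyD _ _) _; rewrite geq_max; apply/andP; split.
    rewrite /Bderiv; apply: leq_trans (size_polyMleq _ _) _.
    have [->|nz] := eqVneq (h i j) 0; first by rewrite deriv0 size_poly0; lia.
    have := lt_size_deriv nz; lia.
  by apply: leq_trans (size_polyMleq _ _) _; have := szq j; lia.
pose H := \matrix_(i < r.+1, j < r.+1) h i j.
have [detH|detH] := eqVneq (\det H) 0.
  have [|c [j0 cj0] sumc] := @wronskian_dependent F p charp B Bneq0 _ f szf.
    rewrite (_ : wronskian B f = \matrix_(i, j) (H i j * f j)).
      by rewrite det_scale_cols detH mul0r.
    by apply/matrixP => i j; rewrite !mxE hE.
  have PE : \sum_j a j *: f j =
      \sum_(j < r) (a (lift j0 j) - a j0 / c j0 * c (lift j0 j)) *: f (lift j0 j).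
    have E : \sum_j (a j0 / c j0) *: (c j *: f j) = 0.
      by rewrite -scaler_sumr sumc scaler0.
    rewrite -[LHS]subr0 -[X in _ - X]E -sumrB.
    rewrite (bigD1_ord j0) //= scalerA divfK // subrr add0r.
    by apply: eq_bigr => j _; rewrite scalerA -scalerBl.
  rewrite PE; apply: (IH _ (fun j => q (lift j0 j))) => //; first by nia.
  by rewrite -PE.
apply: big1 => j _; have [->|aj] := eqVneq (a j) 0; first by rewrite scale0r.
pose P := \sum_j a j *: f j.
have DP (i : nat) : iter i (Bderiv B) P = \sum_j h i j * (a j *: f j).
  elim: i => [|i IHi]; first by apply: eq_bigr => k _; rewrite mul1r.
  rewrite iterS IHi Bderiv_sum; apply: eq_bigr => k _.
  by rewrite hS BderivM BderivZ Df -!mul_polyC; ring.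
(* [T ^+ N] divides [P], and each application of [D] costs one factor of [T]. At most [r] are
   applied, and [(r + 1)^2 + 1 + r] is exactly the assumed lower bound on [N]. *)
have TdetH : T ^+ (r.+1 * r.+1).+1 %| \det H * (a j *: f j).
  have E : \det H * (a j *: f j) = \sum_i \adj H j i * iter i (Bderiv B) P.
    have : \adj H *m (H *m \col_k (a k *: f k)) = \det H *: \col_k (a k *: f k).
      by rewrite mulmxA mul_adj_mx mul_scalar_mx.
    move=> /matrixP/(_ j 0); rewrite !mxE => <-; apply: eq_bigr => i _.
    by rewrite DP !mxE; congr (_ * _); apply: eq_bigr => k _; rewrite !mxE.
  rewrite E; elim/big_rec: _ => [|i x _ IHx]; first exact: dvdp0.
  rewrite dvdp_add // dvdp_mull //; apply: dvdp_iter_Bderiv.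
  apply: dvdp_trans TP; apply: dvdp_exp2l; have := ltn_ord i; nia.
(* [f j] does not vanish at [rho], hence is coprime to [T], so all of the multiplicity falls on
   [\det H], whose degree is too small for it. *)
have : T ^+ (r.+1 * r.+1).+1 %| \det H.
  move: TdetH; rewrite -scalerAr dvdpZr // Gauss_dvdpl //.
  by rewrite coprimep_expl // coprimep_sym coprimep_XsubC /root frho.
move=> /(dvdp_leq detH); rewrite size_exp_XsubC => le1.
have le2 : (size (\det H) <= (r.+1 * r.+1).+1)%N.
  by apply: size_det_le => i k; rewrite mxE.
by have := leq_trans le1 le2; rewrite ltnn.
Qed.

End Multiplicity.

Lemma size_linear (R : nzRingType) (u v : R) : (size (u *: 'X + v%:P)%R <= 2)%N.
Proof.
apply: leq_trans (size_polyD _ _) _; rewrite geq_max.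
rewrite (leq_trans (size_scale_leq _ _)) ?size_polyX //.
by rewrite (leq_trans (size_polyC_leq1 _)).
Qed.

Lemma size_linear_exp (R : nzRingType) (u v : R) n :
  (size ((u *: 'X + v%:P) ^+ n)%R <= n.+1)%N.
Proof.
apply: leq_trans (size_poly_exp_leq _ _) _; rewrite ltnS -[leqRHS]mul1n leq_mul2r.
by have := size_linear u v; case: (size _) => [|[|[]]] // _; rewrite orbT.
Qed.

Lemma size_sparse_shift (F : fieldType) (u v : F) k (a : 'I_k -> F)
    (alpha beta : 'I_k -> nat) p :
  (forall j, alpha j + beta j < p)%N ->
  (size (sparse_shift_poly u v a alpha beta) <= p)%N.
Proof.
move=> ltp; apply: (leq_trans (size_sum _ _ _)); apply/bigmax_leqP => j _.
rewrite -mulrA mul_polyC; apply: leq_trans (size_scale_leq _ _) _.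
apply: leq_trans (size_polyMleq _ _) _; rewrite size_polyXn.
by rewrite addSn (leq_trans (leq_add (leqnn _) (size_linear_exp _ _ _))) // addnS.
Qed.

Lemma sparse_shift_eq0 (F : fieldType) p (u v : F) k (a : 'I_k -> F)
    (alpha beta : 'I_k -> nat) N :
  p \in [pchar F] -> (forall j, alpha j + beta j < p)%N ->
  (k * k + k <= N)%N -> (2 <= N)%N ->
  let P := sparse_shift_poly u v a alpha beta in
  ('X - 1%:P) ^+ N %| P -> ('X - 2%:R%:P) ^+ N %| P -> P = 0.
Proof.
move=> charp ltp leN le2 P dvd1 dvd2; have szP := size_sparse_shift u v a ltp.
have p_pr : prime p := (andP charp).1.
(* For [p = 2] the point 2 is 0 and cannot be used; but then [P] has degree at most 1, and [N >= 2]
   forces it to vanish. *)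
have [p2|p2] := eqVneq p 2%N.
  apply/eqP; apply: contraTT dvd1 => Pn0; apply/negP => /(dvdp_leq Pn0).
  by rewrite size_exp_XsubC => le; have := leq_trans le szP; rewrite p2; lia.
have two0 : 2%:R != 0 :> F.
  rewrite -(dvdn_pcharf charp) dvdn_prime2 //.
have szX j : (size ('X^(alpha j) : {poly F}) <= p)%N.
  by rewrite size_polyXn; have := ltp j; lia.
(* If [u = v = 0], only the terms with [beta j = 0] survive, as [0^0 = 1]; they are monomials, and
   [B = X] suffices. *)
have [/andP[/eqP u0 /eqP v0]|uv] := boolP ((u == 0) && (v == 0)).
  have PE : P = \sum_j (if beta j == 0%N then a j else 0) *: 'X^(alpha j).
    apply: eq_bigr => j _; rewrite u0 v0 scale0r polyC0 addr0 expr0n.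
    by case: eqP => _; rewrite ?mulr1 ?mulr0 ?scale0r ?mul_polyC.
  rewrite PE; apply: (@multiplicity_bound F p charp 'X 1 _ _ _ _
                        (fun j => (alpha j)%:R%:P) _ N) => //.
  - by rewrite polyX_eq0.
  - by rewrite size_polyX.
  - move=> j; rewrite /Bderiv derivXn; case: (alpha j) => [|n].
      by rewrite mulr0n mulr0 polyC0 mul0r.
    by rewrite mulrnAr -exprS polyC_natr mulr_natl.
  - by move=> j; rewrite (leq_trans (size_polyC_leq1 _)).
  - by move=> j; rewrite hornerXn expr1n oner_neq0.
  - by rewrite -PE.
pose L : {poly F} := u *: 'X + v%:P.
have [rho [rho0 Lrho dvd]] : exists rho, [/\ rho != 0, L.[rho] != 0 &
    ('X - rho%:P) ^+ N %| P].
  have [uv1|uv1] := eqVneq L.[1] 0; last by exists 1; rewrite oner_neq0.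
  exists 2%:R; split=> //; apply: contra uv => /eqP uv2.
  move: uv1 uv2; rewrite !hornerE => uv1 uv2.
  have u0 : u = 0 by have : (u * 2%:R + v) - (u + v) = 0; [rewrite uv1 uv2 subrr | move=> <-; ring].
  by move: uv1; rewrite u0 eqxx add0r => ->; rewrite eqxx.
have szL : (size L <= 2)%N := size_linear u v.
have L0 : L != 0 by apply: contraNneq Lrho => ->; rewrite horner0.
have dL : L^`() = u%:P by rewrite derivD derivZ derivX derivC addr0 alg_polyC.
have PE : P = \sum_j a j *: ('X^(alpha j) * L ^+ beta j).
  by apply: eq_bigr => j _; rewrite -mulrA mul_polyC.
(* The multiplier is [X L] times the logarithmic derivative [alpha / X + beta u / L]. *)
rewrite PE; apply: (@multiplicity_bound F p charp ('X * L) rho _ _ _ _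
  (fun j => (alpha j)%:R%:P * L + (beta j)%:R%:P * u%:P * 'X) _ N) => //.
- by rewrite mulf_neq0 // polyX_eq0.
- by apply: leq_trans (size_polyMleq _ _) _; rewrite size_polyX; lia.
- move=> j; rewrite /Bderiv derivM derivXn deriv_exp dL !polyC_natr.
  set A0 := _ *+ alpha j; set B0 := _ *+ beta j.
  have XA : 'X * A0 = (alpha j)%:R * 'X^(alpha j).
    rewrite /A0; case: (alpha j) => [|n]; first by rewrite mulr0n mulr0 mul0r.
    by rewrite mulrnAr -exprS mulr_natl.
  have LB : L * B0 = (beta j)%:R * u%:P * L ^+ beta j.
    rewrite /B0; case: (beta j) => [|n]; first by rewrite mulr0n mulr0 !mul0r.
    by rewrite mulrnAr mulrCA -exprS -mulrA mulr_natl.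
  transitivity ('X * A0 * (L * L ^+ beta j) + 'X * 'X^(alpha j) * (L * B0)); first by ring.
  by rewrite XA LB; ring.
- move=> j; apply: leq_trans (size_polyD _ _) _; rewrite geq_max; apply/andP; split.
    by rewrite mul_polyC (leq_trans (size_scale_leq _ _)).
  by rewrite -polyCM mul_polyC (leq_trans (size_scale_leq _ _)) // size_polyX.
- move=> j; apply: leq_trans (size_polyMleq _ _) _; rewrite size_polyXn.
  by rewrite addSn (leq_trans (leq_add (leqnn _) (size_linear_exp _ _ _))) // addnS.
- by move=> j; rewrite hornerM hornerXn horner_exp mulf_neq0 // expf_neq0.
- by rewrite -PE.
Qed.

(** * Correctness *)

Definition bval (x : seq bool) : nat := foldr (fun (b : bool) n => b + n.*2)%N 0%N x.

Lemma bval_cons b x : bval (b :: x) = (b + (bval x).*2)%N.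
Proof. by []. Qed.

Lemma bval_lt x : (bval x < 2 ^ size x)%N.
Proof. by elim: x => //= b x IH; rewrite expnS; case: b; lia. Qed.

Lemma bval_bits n : bval (bits n) = n.
Proof.
rewrite /bits; have : (n <= n)%N by []; move: {2 3}n => fuel.
elim: fuel n => [|fuel IH] n; first by rewrite leqn0 => /eqP->.
move=> le; rewrite /=; case: eqP => [->//|n0]; rewrite bval_cons IH.
  by rewrite odd_double_half.
by rewrite -ltnS; apply: leq_trans le; rewrite ltn_half_double; lia.
Qed.

Lemma bval_take n x : bval (take n x) = (bval x %% 2 ^ n)%N.
Proof.
elim: n x => [|n IH] [|b x] //=; rewrite ?expn0 ?modn1 ?mod0n //.
rewrite IH expnS.
have lt := ltn_pmod (bval x) (expn_gt0 2 n : (0 < 2 ^ n)%N).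
have E := divn_eq (bval x) (2 ^ n); set r := (bval x %% _)%N in lt E *.
have -> : (b + (bval x).*2 = bval x %/ 2 ^ n * (2 * 2 ^ n) + (b + r.*2))%N.
  by rewrite {1}E; lia.
by rewrite modnMDl modn_small //; case: b; lia.
Qed.

Lemma bval_cat_zeros x (p : seq bool) : bval (x ++ zerom p) = bval x.
Proof.
elim: x => [|b x IH] /=; last by rewrite IH.
by elim: p => //= b p; rewrite /zerom => ->.
Qed.

Lemma bval_eq0 x : all negb x = (bval x == 0%N).
Proof. by elim: x => //= b x ->; rewrite addn_eq0 double_eq0; case: b. Qed.

Lemma bval_fit p x : (bval x < 2 ^ size p)%N ->
  size (fit p x) = size p /\ bval (fit p x) = bval x.
Proof.
move=> lt; rewrite /fit takecE size_take size_cat size_map; split.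
  by case: ltnP; lia.
by rewrite bval_take bval_cat_zeros modn_small.
Qed.

Lemma adder_spec c x y : size x = size y ->
  size (adder c x y).1 = size y /\
  (bval (adder c x y).1 + (adder c x y).2 * 2 ^ size y = bval x + bval y + c)%N.
Proof.
rewrite /adder => szxy.
suff [s [c' [-> ss E]]] : exists s c', [/\ foldl full_add ([::], c) (zip x y) =
    (catrev s [::], c'), size s = size y &
    (bval s + c' * 2 ^ size y = bval x + bval y + c)%N].
  by rewrite /= -/(rev s) revK.
elim: x y c [::] szxy => [|a x IH] [|b y] c acc //= szxy.
  by exists [::], c; split=> //=; lia.
case: szxy => szxy.
have [s [c' [E ss Es]]] := IH y ((a && b) || (c && (a || b))) (a (+) b (+) c :: acc) szxy.
exists (a (+) b (+) c :: s), c'; split=> //=; first by rewrite ss.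
by rewrite expnS; move: Es; case: (a); case: (b); case: (c) => /=; lia.
Qed.

Lemma bval_negb p : (bval (map negb p) + bval p + 1 = 2 ^ size p)%N.
Proof. by elim: p => //= b p; rewrite expnS; case: b => /=; lia. Qed.

Lemma bval_ones (p : seq bool) : (bval (map (fun=> true) p) + 1 = 2 ^ size p)%N.
Proof. by elim: p => //= b p; rewrite expnS; lia. Qed.

Lemma bval_zerom p : bval (zerom p) = 0%N.
Proof. exact: bval_cat_zeros [::] p. Qed.

(** * Binary arithmetic modulo p *)

Section Residues.
Variable p : seq bool.
Hypothesis p_gt1 : (1 < bval p)%N.

Definition residue (x : seq bool) := (size x == size p) && (bval x < bval p)%N.

(** With [E = 2 ^ size p], the second addition computes [s + E - p]. If the first one carried, this
    equals [x + y - p < E] and [d] is the result; otherwise its carry tells whether [s >= p]. *)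
Lemma addm_spec x y : residue x -> residue y -> residue (addm p x y) /\
  exists b : bool, (bval (addm p x y) + b * bval p = bval x + bval y)%N.
Proof.
move=> /andP[/eqP sx ltx] /andP[/eqP sy lty].
rewrite /addm takecE; have [ss Es] := @adder_spec false x y (etrans sx (esym sy)).
move: (adder false x y) ss Es => [s c1]; cbn [fst snd] => ss Es.
have [|sd Ed] := @adder_spec true s (map negb p); first by rewrite size_map ss.
move: (adder true _ _) sd Ed => [d c2]; cbn [fst snd]; rewrite size_map => sd Ed.
have En := bval_negb p; have lts := bval_lt s; have ltd := bval_lt d.
have ltp := bval_lt p.
have sr : size (if c1 || c2 then d else s) = size p.
  by case: ifP; rewrite ?sd ?ss ?sy.
rewrite take_oversize ?sr // /residue sr eqxx /=.
rewrite ss sy in Es lts; rewrite sd in ltd.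
move: (2 ^ size p)%N Es Ed En lts ltd ltp => E Es Ed En lts ltd ltp.
case: c1 Es Ed {sr} => /= Es Ed.
  by split; [|exists true]; case: c2 Ed => /=; lia.
case: c2 Ed => /= Ed; first by split; [|exists true]; lia.
by split; [|exists false]; lia.
Qed.

Variable F : comNzRingType.
Hypothesis charp : (bval p)%:R = 0 :> F.

Definition rsem (x : seq bool) : F := (bval x)%:R.

Lemma addm_sem x y : residue x -> residue y ->
  residue (addm p x y) /\ rsem (addm p x y) = rsem x + rsem y.
Proof.
move=> rx ry; have [r [b E]] := addm_spec rx ry; split=> //.
by rewrite /rsem -natrD -E natrD natrM charp mulr0 addr0.
Qed.

Lemma zerom_sem : residue (zerom p) /\ rsem (zerom p) = 0.
Proof. by rewrite /residue /rsem size_map bval_zerom eqxx (ltn_trans _ p_gt1). Qed.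

Lemma onem_sem : residue (onem p) /\ rsem (onem p) = 1.
Proof.
rewrite /residue /rsem /onem; case: p p_gt1 => // b p' gt1.
by rewrite bval_cons bval_zerom /= size_map eqxx.
Qed.

Lemma mulm_sem x y : residue y ->
  residue (mulm p x y) /\ rsem (mulm p x y) = rsem x * rsem y.
Proof.
move=> ry; elim: x => [|b x [rx sx]] /=.
  by have [r0 ->] := zerom_sem; rewrite /rsem mul0r.
have [r2 s2] := addm_sem rx rx; rewrite sx in s2.
have E : rsem (b :: x) = b%:R + (rsem x + rsem x).
  by rewrite /rsem bval_cons natrD -addnn natrD.
rewrite E; case: b {E}.
  have [r3 ->] := addm_sem r2 ry; split=> //.
  by rewrite s2 mulrDl [_%:R * _]mul1r; ring.
by split=> //; rewrite s2 add0r; ring.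
Qed.

Lemma minus_one_sem : rsem (minus_one p) = -1.
Proof.
rewrite /minus_one; have [|ss Es] := @adder_spec false p (map (fun=> true) p).
  by rewrite size_map.
move: (adder _ _ _) ss Es => [s c] /= ss; rewrite size_map => Es.
have := bval_ones p; have := bval_lt p; have := bval_lt s.
rewrite ss size_map; move: (2 ^ size p)%N Es => E Es lts ltp E1.
have {Es} Es : (bval s + 1 = bval p)%N by case: c Es => /=; lia.
by apply/eqP; rewrite -addr_eq0 /rsem natr1 -addn1 Es charp.
Qed.

End Residues.

(** The interface passed up the tower: operations that are correct on the representatives singled
    out by [valid], and a test that recognises exactly the representatives of zero. *)
Record implements (R : comNzRingType) (X : Type) (add mul : X -> X -> X)
    (zero one : X) (isz : X -> bool) (valid : X -> Prop) (sem : X -> R) : Prop := {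
  impD : forall x y, valid x -> valid y ->
    valid (add x y) /\ sem (add x y) = sem x + sem y;
  impM : forall x y, valid x -> valid y ->
    valid (mul x y) /\ sem (mul x y) = sem x * sem y;
  imp0 : valid zero /\ sem zero = 0;
  imp1 : valid one /\ sem one = 1;
  impz : forall x, valid x -> isz x = (sem x == 0)
}.

Lemma implements_Fp (p : nat) : prime p ->
  let P := bits p in
  implements (addm P) (mulm P) (zerom P) (onem P) (all negb)
    (fun x => residue P x) (rsem 'F_p).
Proof.
move=> p_pr P; have Pp : bval P = p by apply: bval_bits.
have gt1 : (1 < bval P)%N by rewrite Pp prime_gt1.
have charp : (bval P)%:R = 0 :> 'F_p by rewrite Pp; apply: pchar_Fp_0.
split.
- by move=> x y; apply: addm_sem.
- by move=> x y _; apply: mulm_sem.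
- exact: zerom_sem.
- exact: onem_sem.
move=> x /andP[_ ltx]; rewrite bval_eq0 /rsem.
rewrite -(dvdn_pcharf (pchar_Fp p_pr)) -Pp.
by apply/eqP/idP => [->|/dvdn_leq H]; [rewrite dvdn0 | case: (bval x) ltx H => // n; lia].
Qed.

Fixpoint all_valid X (valid : X -> Prop) (l : seq X) : Prop :=
  if l is x :: l' then valid x /\ all_valid valid l' else True.

(** * One extension step of the tower *)

Section ExtensionCorrect.
Variables (R S : comNzRingType) (E X : Type).
Variables (add mul : E -> X -> X -> X) (zero one : E -> X).
Variables (isz : X -> bool) (valid : X -> Prop) (sem : X -> R).
Variables (e : E) (m : seq X).
Hypothesis impR : implements (add e) (mul e) (zero e) (one e) isz valid sem.
Hypotheses (validm : all_valid valid m) (m_gt0 : (0 < size m)%N).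

Definition lpoly (l : seq X) : {poly R} := Poly (map sem l).

(** The quotient map, known only through these properties, so that one proof serves for the moduli
    [phi] and [X^N]. [pr_inj] says that reduced representatives are unique, which the zero test
    needs. *)
Variable pr : {poly R} -> S.
Hypotheses (prD : forall a b, pr (a + b) = pr a + pr b)
           (prM : forall a b, pr (a * b) = pr a * pr b)
           (pr1 : pr 1 = 1)
           (prm : pr 'X^(size m) = pr (lpoly m))
           (pr_inj : forall a : {poly R}, (size a <= size m)%N -> pr a = 0 -> a = 0).

Definition xvalid (l : seq X) := size l = size m /\ all_valid valid l.
Definition xsem (l : seq X) : S := pr (lpoly l).

Let pr0 : pr 0 = 0.
Proof. by apply: (addIr (pr 0)); rewrite -prD !add0r. Qed.

Lemma lpoly_cons x l : lpoly (x :: l) = lpoly l * 'X + (sem x)%:P.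
Proof. by rewrite /lpoly /= cons_poly_def. Qed.

(** Longer operands are allowed because [xshift] passes a list with one extra entry and relies on
    the truncation. *)
Lemma xadd_spec x y : (size m <= size x)%N -> (size m <= size y)%N ->
  all_valid valid x -> all_valid valid y ->
  xvalid (xadd add (e, m) x y) /\
  lpoly (xadd add (e, m) x y) = lpoly (take (size m) x) + lpoly (take (size m) y).
Proof.
rewrite /xadd /xvalid takecE /=; move: (size m) => n.
elim: n x y => [|n IH] x y; first by rewrite !take0 /lpoly /= addr0.
case: x => // a x; case: y => // b y szx szy.
move=> [va vx] [vb vy]; have [[sz vz] Ez] := IH x y szx szy vx vy.
have [vab Eab] := impD impR va vb; split; first by rewrite /= sz.
by rewrite /= !lpoly_cons Ez Eab polyCD; ring.
Qed.

Lemma xscale_spec c y : valid c -> all_valid valid y ->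
  all_valid valid (xscale mul (e, m) c y) /\
  lpoly (xscale mul (e, m) c y) = (sem c)%:P * lpoly y.
Proof.
move=> vc; elim: y => [_|a y IH [va vy]] /=; first by rewrite /lpoly mulr0.
have [vy' Ey] := IH vy; have [vca Eca] := impM impR vc va.
by rewrite !lpoly_cons /= Ey Eca polyCM; split=> //; ring.
Qed.

Lemma all_valid_nseq T n x : valid x -> all_valid valid (map (fun=> x) (n : seq T)).
Proof. by move=> vx; elim: n. Qed.

Lemma lpoly_zeros T (n : seq T) : lpoly (map (fun=> zero e) n) = 0.
Proof.
elim: n => [|y n IH]; rewrite ?lpoly_cons /= ?IH //.
by have [_ ->] := imp0 impR; rewrite mul0r add0r.
Qed.

Lemma xzero_spec : xvalid (xzero zero (e, m)) /\ xsem (xzero zero (e, m)) = 0.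
Proof.
rewrite /xvalid /xsem /xzero size_map lpoly_zeros; split=> //; split=> //.
by apply: all_valid_nseq; have [] := imp0 impR.
Qed.

Lemma xone_spec : xvalid (xone zero one (e, m)) /\ xsem (xone zero one (e, m)) = 1.
Proof.
rewrite /xvalid /xsem /xone /=; case: (m) m_gt0 => // x0 m' _.
have [v1 E1] := imp1 impR; have [v0 _] := imp0 impR; split.
  by split; rewrite /= ?size_map //; split=> //; apply: all_valid_nseq.
by rewrite lpoly_cons lpoly_zeros E1 mul0r add0r.
Qed.

Lemma lpoly_rcons l x : lpoly (rcons l x) = lpoly l + (sem x)%:P * 'X^(size l).
Proof.
elim: l => [|y l IH] /=; rewrite ?lpoly_cons /= ?IH.
  by rewrite /lpoly /= mul0r !add0r mulr1.
by rewrite exprS; ring.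
Qed.

Lemma all_valid_rcons l x : all_valid valid (rcons l x) <-> all_valid valid l /\ valid x.
Proof. by elim: l => [|y l IH] /=; tauto. Qed.

Lemma xshift_spec x : xvalid x ->
  xvalid (xshift add mul zero (e, m) x) /\
  xsem (xshift add mul zero (e, m) x) = pr 'X * xsem x.
Proof.
case=> sx vx; rewrite /xshift /=.
have [v0 E0] := imp0 impR.
case: (lastP x) sx vx => [sx|x' t sx /all_valid_rcons [vx' vt]]; first by have := m_gt0; rewrite -sx.
rewrite last_rcons; have [vs Es] := xscale_spec vt validm.
have [||||vr Er] := @xadd_spec (zero e :: rcons x' t) (xscale mul (e, m) t m).
- by rewrite /= sx; lia.
- by rewrite size_map.
- by split=> //; apply/all_valid_rcons.
- exact: vs.
split=> //; rewrite /xsem Er [take _ (xscale _ _ _ _)]take_oversize; last first.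
  by rewrite size_map.
rewrite Es.
rewrite -rcons_cons -cats1 take_size_cat; last by rewrite /= -sx size_rcons.
rewrite lpoly_cons E0 addr0 lpoly_rcons !prD !prM -prm -sx size_rcons exprS prM.
by ring.
Qed.

Lemma xmul_spec x y : all_valid valid x -> xvalid y ->
  xvalid (xmul add mul zero (e, m) x y) /\
  xsem (xmul add mul zero (e, m) x y) = xsem x * xsem y.
Proof.
move=> vx [sy vy]; elim: x vx => [_|c x IH [vc vx]] /=.
  have [v0 ->] := xzero_spec; split=> //.
  by rewrite /xsem /lpoly /= pr0 mul0r.
have [vxy Exy] := IH vx; have [[ss vs] Es] := xshift_spec vxy.
have [vc' Ec'] := xscale_spec vc vy.
have [||||vr Er] := @xadd_spec (xscale mul (e, m) c y)
   (xshift add mul zero (e, m) (xmul add mul zero (e, m) x y)) => //.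
- by rewrite size_map sy.
- by rewrite ss.
split=> //; rewrite /xsem Er [take _ (xscale _ _ _ _)]take_oversize; last first.
  by rewrite size_map sy.
rewrite take_oversize ?ss // Ec' prD -/(xsem (xshift _ _ _ _ _)) Es Exy.
by rewrite lpoly_cons prD !prM -/(xsem x) -/(xsem y); ring.
Qed.

Lemma all_isz l : all_valid valid l -> all isz l = (lpoly l == 0).
Proof.
elim: l => [_|x l IH [vx vl]]; first by rewrite /lpoly eqxx.
rewrite /= (impz impR vx) IH // lpoly_cons.
apply/andP/eqP => [[/eqP-> /eqP->]|Ep]; first by rewrite mul0r add0r.
have c0 : sem x = 0 by have /polyP/(_ 0%N) := Ep; rewrite coefD coefMX coefC add0r coef0.
split; rewrite ?c0 //; apply/eqP/polyP => i.
by have /polyP/(_ i.+1) := Ep; rewrite coefD coefMX coefC addr0 !coef0.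
Qed.

Lemma implements_extension :
  implements (xadd add (e, m)) (xmul add mul zero (e, m)) (xzero zero (e, m))
    (xone zero one (e, m)) (all isz) xvalid xsem.
Proof.
split.
- move=> x y [sx vx] [sy vy]; have [||vr Er] := @xadd_spec x y _ _ vx vy.
  + by rewrite sx.
  + by rewrite sy.
  by split=> //; rewrite /xsem Er !take_oversize ?sx ?sy // prD.
- by move=> x y [_ vx] vy; apply: xmul_spec.
- exact: xzero_spec.
- exact: xone_spec.
move=> x [sx vx]; rewrite all_isz //; apply/eqP/eqP => [|]; rewrite /xsem.
  by move=> ->.
by apply: pr_inj; rewrite -sx -(size_map sem x); apply: size_Poly.
Qed.

End ExtensionCorrect.

Lemma pow_spec (R : comNzRingType) E X (add mul : E -> X -> X -> X) (zero one : E -> X)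
    isz valid (sem : X -> R) e :
  implements (add e) (mul e) (zero e) (one e) isz valid sem ->
  forall x n, valid x ->
  valid (pow mul one e x n) /\ sem (pow mul one e x n) = sem x ^+ bval n.
Proof.
move=> imp x n vx; elim: n => [|b n [vn En]] /=; first exact: imp1 imp.
have [v2 E2] := impM imp vn vn; rewrite En -exprD addnn in E2.
case: b; last by rewrite E2.
have [v3 ->] := impM imp v2 vx; split=> //.
by rewrite E2 add1n exprSr.
Qed.

Lemma parse_enc_nats L : parse_nats (enc_nats L) = map bits L.
Proof.
rewrite /parse_nats.
(* From the right, the terminator is met first and opens an empty number; the pairs then prepend
   their bits to it. *)
have bitsP (l h : seq bool) out :
    foldr parse_step ([::], h :: out) (flatten [seq [:: true; b] | b <- l]) =
    ([::], (l ++ h) :: out).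
  by elim: l => //= b l ->.
suff -> : foldr parse_step ([::], [::]) (enc_nats L) = ([::], map bits L) by [].
elim: L => //= n L IH.
by rewrite /enc_nats /= foldr_cat -/(enc_nats L) IH /enc_nat foldr_cat /= bitsP cats0.
Qed.

Lemma size_unary X (c : seq X) n : (bval n <= size c)%N -> size (unary c n) = bval n.
Proof.
elim: n => [|b n IH] //=; rewrite -/(unary c n) takecE => le.
have sz : size (unary c n) = bval n by apply: IH; lia.
by rewrite size_take_min !size_cat sz; case: b le => /=; lia.
Qed.

Lemma chunksE X (s : seq bool) (cs : seq (seq X)) : (0 < size s)%N ->
  all (fun c => size c == size s) cs -> chunks s (flatten cs) = rev cs.
Proof.
move=> s_gt0 szcs; rewrite /chunks.
have : (size cs <= size (flatten cs))%N.
  elim: cs szcs => //= c cs IH /andP[/eqP sc /IH]; rewrite size_cat sc; lia.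
(* Only the length of the fuel matters, so it is separated from the list being cut. *)
suff H (t : seq X) acc : (size cs <= size t)%N ->
    foldl (fun st _ => chunk_step s st) (flatten cs, acc) t = ([::], catrev cs acc).
  by move=> /H ->.
elim: t cs szcs acc => [|x t IH] [|c cs] szcs acc //= le.
  exact: (IH [::]).
move: le; case/andP: szcs => /eqP sc szcs; rewrite ltnS => /(IH cs szcs) <-.
congr foldl; rewrite /chunk_step /=.
case E: (c ++ flatten cs) => [|y l]; first by move: (congr1 size E); rewrite size_cat sc /=; lia.
by rewrite -E dropcE takecE -sc drop_size_cat // take_size_cat.
Qed.

Lemma map_const T U (x : U) (l : seq T) : map (fun=> x) l = nseq (size l) x.
Proof. by elim: l => //= _ l ->. Qed.

Lemma behead_nseq T n (x : T) : behead (nseq n x) = nseq n.-1 x.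
Proof. by case: n. Qed.

Lemma pad3E X (L : seq X) z : pad3 L z = nseq (size L * size L + 2) z.
Proof.
rewrite /pad3 map_const; move: {1 3}(size L) => n.
by elim: L => //= _ L ->; rewrite -nseqD; congr nseq; lia.
Qed.

(** * The field and the truncated ring of an instance *)

Section Instance.
Variables (p : nat) (phi : {poly 'F_p}) (hphi : monic_irreducible_poly phi).
Hypothesis p_pr : prime p.

Let K := GFq hphi.
Let s := (size phi).-1.
Let P := bits p.

Definition enc_elt (x : nat) : seq bool := fit P (bits x).

Definition enc_poly (q : {poly 'F_p}) : seq (seq bool) :=
  [seq enc_elt x | x <- enc_coeffs s q].

Lemma bval_enc_elt x : (x < p)%N -> size (enc_elt x) = size P /\ bval (enc_elt x) = x.
Proof.
move=> ltx; have [|sz E] := @bval_fit P (bits x).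
  by rewrite bval_bits (ltn_trans ltx) // -{1}(bval_bits p) bval_lt.
by rewrite E bval_bits.
Qed.

Lemma residue_enc_elt x : (x < p)%N -> residue P (enc_elt x).
Proof.
by move=> ltx; have [sz E] := bval_enc_elt ltx; rewrite /residue sz E bval_bits eqxx.
Qed.

Lemma ltn_Fp (c : 'F_p) : (c < p)%N.
Proof. by have := ltn_ord c; rewrite [X in (_ < X)%N]Fp_cast. Qed.

Lemma rsem_enc_elt (c : 'F_p) : rsem 'F_p (enc_elt c) = c.
Proof. by have [_ E] := bval_enc_elt (ltn_Fp c); rewrite /rsem E natr_Zp. Qed.

Let phi_gt1 : (1 < size phi)%N. Proof. by case: hphi => -[]. Qed.
Let s_gt0 : (0 < s)%N. Proof. by rewrite -ltnS (prednK (ltnW phi_gt1)). Qed.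
Let phi_monic : phi \is monic. Proof. by case: hphi. Qed.

Lemma size_enc_poly q : size (enc_poly q) = s.
Proof. by rewrite !size_map size_iota. Qed.

Lemma valid_enc_poly q : all_valid (fun x => residue P x) (enc_poly q).
Proof.
rewrite /enc_poly /enc_coeffs; elim: (iota 0 s) => //= i l IH; split=> //.
exact/residue_enc_elt/ltn_Fp.
Qed.

Lemma lpoly_enc_poly q : lpoly (rsem 'F_p) (enc_poly q) = Poly [seq q`_i | i <- iota 0 s].
Proof.
by rewrite /lpoly -!map_comp; congr Poly; apply: eq_map => i /=; rewrite rsem_enc_elt.
Qed.

Lemma lpoly_enc_poly_small (q : {poly 'F_p}) : (size q <= s)%N ->
  lpoly (rsem 'F_p) (enc_poly q) = q.
Proof.
move=> szq; rewrite lpoly_enc_poly; apply/polyP => i; rewrite coef_Poly.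
have [lti|gei] := ltnP i s; first by rewrite (nth_map 0%N) ?size_iota // nth_iota.
by rewrite !nth_default ?size_map ?size_iota // (leq_trans szq).
Qed.

(** As [phi] is monic, [xi^s] equals minus the lower part of [phi] in the quotient. *)
Let m := map (mulm P (minus_one P)) (enc_poly phi).

Let P_gt1 : (1 < bval P)%N. Proof. by rewrite bval_bits prime_gt1. Qed.
Let charP : (bval P)%:R = 0 :> 'F_p. Proof. by rewrite bval_bits; apply: pchar_Fp_0. Qed.

Lemma valid_modulus : all_valid (fun x => residue P x) m.
Proof.
rewrite /m; elim: (enc_poly phi) (valid_enc_poly phi) => //= x l IH [rx rl].
by split; [have [] := mulm_sem P_gt1 charP (minus_one P) rx | apply: IH].
Qed.

Lemma lpoly_modulus : 'X^s - lpoly (rsem 'F_p) m = phi.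
Proof.
have -> : lpoly (rsem 'F_p) m = - Poly [seq phi`_i | i <- iota 0 s].
  rewrite -lpoly_enc_poly /m; elim: (enc_poly phi) (valid_enc_poly phi) => [_|x l IH [rx rl]].
    by rewrite /lpoly oppr0.
  rewrite /= !lpoly_cons IH //; have [_ ->] := mulm_sem P_gt1 charP (minus_one P) rx.
  by rewrite minus_one_sem // mulN1r polyCN; ring.
rewrite opprK; apply/polyP => i; rewrite coefD coefXn coef_Poly.
have sE : size phi = s.+1 by rewrite /s (prednK (ltnW phi_gt1)).
case: (ltngtP i s) => [lti|gti|->].
- by rewrite (nth_map 0%N) ?size_iota // nth_iota // add0r.
- by rewrite !nth_default ?size_map ?size_iota ?addr0 ?sE // ltnW.
rewrite nth_default ?size_map ?size_iota // addr0.
by rewrite -[s]/((size phi).-1) -/(lead_coef phi) (monicP phi_monic).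
Qed.

Definition qproj : {poly 'F_p} -> K := in_qpoly phi.

Lemma qproj_phi : qproj phi = 0.
Proof. by apply: val_inj; rewrite /= mk_monicE // Pdiv.RingMonic.rmodpp. Qed.

Lemma qprojD a b : qproj (a + b) = qproj a + qproj b.
Proof. exact: in_qpolyD. Qed.

Lemma implements_GFq :
  implements (add2 (P, m)) (mul2 (P, m)) (zero2 (P, m)) (one2 (P, m)) (all (all negb))
    (xvalid (fun x => residue P x) m) (xsem (rsem 'F_p) qproj : _ -> K).
Proof.
apply: (implements_extension (implements_Fp p_pr) valid_modulus).
- by rewrite size_map size_enc_poly.
- exact: qprojD.
- exact: in_qpolyM.
- exact: in_qpoly1.
- rewrite size_map size_enc_poly; have E := lpoly_modulus.
  by rewrite -[in LHS](subrK (lpoly (rsem 'F_p) m) 'X^s) E qprojD qproj_phi add0r.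
- move=> a; rewrite size_map size_enc_poly => sza /(congr1 (@polyn _ _)).
  by rewrite in_qpoly_small // mk_monicE // -(prednK (ltnW phi_gt1)) ltnS.
Qed.

Lemma sem_enc_field (x : GFq hphi) :
  xvalid (fun x => residue P x) m (enc_poly (field_elt_poly x)) /\
  xsem (rsem 'F_p) qproj (enc_poly (field_elt_poly x)) = x.
Proof.
split; first by split; [rewrite (size_map _ (enc_poly phi)) !size_enc_poly | apply: valid_enc_poly].
have szx : (size (field_elt_poly x) < size phi)%N.
  apply: leq_trans (size_mk_monic (x : {poly %/ phi})) _.
  by rewrite (mk_monicE hphi).
rewrite /xsem lpoly_enc_poly_small; last by rewrite -ltnS (prednK (ltnW phi_gt1)).
by apply: val_inj; apply: in_qpoly_small; rewrite mk_monicE.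
Qed.

Section Truncated.
Variables (u v : K) (k : nat) (a : 'I_k -> K) (alpha beta : 'I_k -> nat).
Hypothesis ltp : forall j, (alpha j + beta j < p)%N.
Variables (N : nat) (sl : seq bool).
Hypotheses (N_gt1 : (1 < N)%N) (size_sl : size sl = s).

Let e2 : env2 := (P, m).
Let mm : elt3 := nseq N (zero2 e2).
Let e3 : env3 := (e2, mm).
Let valid2 := xvalid (fun x => residue P x) m.
Let sem2 : elt2 -> K := xsem (rsem 'F_p) qproj.
Let imp2 : implements (add2 e2) (mul2 e2) (zero2 e2) (one2 e2) (all (all negb))
  valid2 sem2 := implements_GFq.

Definition tproj : {poly K} -> {poly %/ ('X^N : {poly K})} := in_qpoly 'X^N.

Let mk_monicN : mk_monic ('X^N : {poly K}) = 'X^N.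
Proof. by rewrite mk_monic_Xn prednK // ltnW. Qed.

Lemma tproj_eq0 (q : {poly K}) : tproj q = 0 -> 'X^N %| q.
Proof.
move/(congr1 (@polyn _ _)) => /=; rewrite mk_monicN => E.
by apply/modp_eq0P; rewrite Pdiv.IdomainMonic.modpE ?monicXn.
Qed.

Lemma tproj0 : tproj 0 = 0.
Proof. exact: in_qpoly0. Qed.

Lemma tprojD f g : tproj (f + g) = tproj f + tproj g.
Proof. exact: in_qpolyD. Qed.

Lemma tprojM f g : tproj (f * g) = tproj f * tproj g.
Proof. exact: in_qpolyM. Qed.

Lemma tprojX f n : tproj (f ^+ n) = tproj f ^+ n.
Proof.
elim: n => [|n IH]; first exact: in_qpoly1.
by rewrite !exprS tprojM IH.
Qed.

Lemma lpoly_nseq_zero n : lpoly sem2 (nseq n (zero2 e2)) = 0.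
Proof.
elim: n => //= n IH; rewrite lpoly_cons IH mul0r add0r.
by have [_ ->] := imp0 imp2.
Qed.

Lemma valid_nseq_zero n : all_valid valid2 (nseq n (zero2 e2)).
Proof. by have [v0 _] := imp0 imp2; elim: n. Qed.

Let valid3 := xvalid valid2 mm.
Let sem3 : elt3 -> {poly %/ ('X^N : {poly K})} := xsem sem2 tproj.

Lemma implements_trunc :
  implements (add3 e3) (mul3 e3) (zero3 e3) (one3 e3) (all (all (all negb))) valid3 sem3.
Proof.
apply: (implements_extension imp2 (valid_nseq_zero N)).
- by rewrite size_nseq ltnW.
- exact: in_qpolyD.
- exact: in_qpolyM.
- exact: in_qpoly1.
- rewrite size_nseq lpoly_nseq_zero; apply: val_inj; rewrite /= mk_monicN.
  by rewrite Pdiv.RingMonic.rmodpp ?monicXn // Pdiv.CommonRing.rmod0p.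
- move=> q; rewrite size_nseq => szq /(congr1 (@polyn _ _)).
  by rewrite in_qpoly_small // mk_monicN size_polyXn ltnS.
Qed.

Let imp3 := implements_trunc.

Lemma linear3_sem c d : valid2 c -> valid2 d ->
  valid3 (linear3 e3 c d) /\ sem3 (linear3 e3 c d) = tproj ((sem2 d) *: 'X + (sem2 c)%:P).
Proof.
move=> vc vd; rewrite /linear3 [e3.2]/= !behead_nseq.
have NE : N = N.-2.+2 by move: N_gt1; lia.
split.
  split; last by do 2!split=> //; apply: valid_nseq_zero.
  by rewrite /mm /= !size_nseq -NE.
by rewrite /sem3 /xsem !lpoly_cons lpoly_nseq_zero mul0r add0r mul_polyC.
Qed.

Lemma const3_sem c : valid2 c ->
  valid3 (const3 e3 c) /\ sem3 (const3 e3 c) = tproj (sem2 c)%:P.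
Proof.
move=> vc; rewrite /const3 [e3.2]/= behead_nseq.
have NE : N = N.-1.+1 by move: N_gt1; lia.
split.
  split; last by split=> //; apply: valid_nseq_zero.
  by rewrite /mm /= !size_nseq -NE.
by rewrite /sem3 /xsem !lpoly_cons lpoly_nseq_zero mul0r add0r.
Qed.

Definition enc_term (j : 'I_k) : seq (seq bool) :=
  enc_poly (@field_elt_poly p phi hphi (a j)) ++ [:: enc_elt (alpha j); enc_elt (beta j)].

Let T j : {poly K} := (a j)%:P * 'X^(alpha j) * (u *: 'X + v%:P) ^+ beta j.

Variables (rho_l ul vl : elt2) (rho : K).
Hypotheses (vrho : valid2 rho_l) (Erho : sem2 rho_l = rho).
Hypotheses (vu : valid2 ul) (Eu : sem2 ul = u) (vv : valid2 vl) (Ev : sem2 vl = v).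

Let x3 := linear3 e3 rho_l (one2 e2).
Let l3 := linear3 e3 (add2 e2 (mul2 e2 ul rho_l) vl) ul.

Lemma term3_sem j : valid3 (term3 e3 x3 l3 sl (enc_term j)) /\
  sem3 (term3 e3 x3 l3 sl (enc_term j)) = tproj (T j \Po ('X + rho%:P)).
Proof.
rewrite /term3 takecE dropcE size_sl /enc_term.
rewrite take_size_cat ?size_enc_poly // drop_size_cat ?size_enc_poly //=.
have [va Ea] : valid2 _ /\ sem2 _ = a j := sem_enc_field (a j).
have [v1 E1] := imp1 imp2; have [vur Eur] := impM imp2 vu vrho.
have [vurv Eurv] := impD imp2 vur vv.
have [vx Ex] := linear3_sem vrho v1; have [vl3 El3] := linear3_sem vurv vu.
have [vc Ec] := const3_sem va.
have [lta ltb] : (alpha j < p)%N /\ (beta j < p)%N by have := ltp j; lia.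
have [_ bA] := bval_enc_elt lta; have [_ bB] := bval_enc_elt ltb.
have [vA EA] := pow_spec imp3 (enc_elt (alpha j)) vx.
have [vB EB] := pow_spec imp3 (enc_elt (beta j)) vl3.
have [vAB EAB] := impM imp3 vA vB; have [vr Er] := impM imp3 vc vAB.
split=> //; rewrite Er Ec EAB EA EB bA bB Ex El3 E1 Ea Eurv Eur Eu Ev Erho scale1r.
have -> : T j \Po ('X + rho%:P) = (a j)%:P * (('X + rho%:P) ^+ alpha j
    * (u *: 'X + (u * rho + v)%:P) ^+ beta j).
  rewrite /T !comp_polyM comp_polyC !rmorphXn /=.
  rewrite comp_polyD comp_polyZ !comp_polyX comp_polyC -mulrA.
  by rewrite scalerDr -addrA polyCD polyCM [u%:P * _]mul_polyC.
by rewrite !tprojM !tprojX.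
Qed.

Lemma total3_sem js : valid3 (total3 e3 x3 l3 sl (map enc_term js)) /\
  sem3 (total3 e3 x3 l3 sl (map enc_term js)) = tproj (\sum_(j <- js) (T j \Po ('X + rho%:P))).
Proof.
elim: js => [|j js [vj Ej]] /=.
  rewrite big_nil; have [v0 ->] := imp0 imp3; split=> //.
  by rewrite tproj0.
have [vt Et] := term3_sem j; have [vr Er] := impD imp3 vt vj.
by split=> //; rewrite Er Et Ej big_cons tprojD.
Qed.

Lemma check_sem : check e3 ul vl sl (rev (map enc_term (enum 'I_k))) rho_l =
  (tproj (sparse_shift_poly u v a alpha beta \Po ('X + rho%:P)) == 0).
Proof.
rewrite /check -map_rev; have [vt Et] := total3_sem (rev (enum 'I_k)).
rewrite (impz imp3 vt) Et; congr (in_qpoly _ _ == 0).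
rewrite /sparse_shift_poly (raddf_sum (comp_poly _)) /=.
by rewrite (perm_big (enum 'I_k)) ?perm_rev //= big_enum.
Qed.

(** Substituting [X - rho] for [X] carries divisibility of [P(X + rho)] by [X^N] over to the point
    [rho]. *)
Lemma check_dvdp : check e3 ul vl sl (rev (map enc_term (enum 'I_k))) rho_l ->
  ('X - rho%:P) ^+ N %| sparse_shift_poly u v a alpha beta.
Proof.
rewrite check_sem => /eqP/tproj_eq0/dvdpP[g].
move/(congr1 (comp_poly ('X - rho%:P))); rewrite -comp_polyA comp_polyD comp_polyX comp_polyC.
rewrite subrK comp_polyXr => ->; rewrite comp_polyM rmorphXn /= comp_polyX.
exact: dvdp_mulIr.
Qed.

Lemma check_eq0 : sparse_shift_poly u v a alpha beta = 0 ->
  check e3 ul vl sl (rev (map enc_term (enum 'I_k))) rho_l.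
Proof. by move=> P0; rewrite check_sem P0 comp_poly0 tproj0. Qed.

End Truncated.
End Instance.

Lemma enc_coeffsS p n (q : {poly 'F_p}) :
  enc_coeffs n.+1 q = enc_coeffs n q ++ [:: nat_of_ord q`_n].
Proof. by rewrite /enc_coeffs -[in iota 0 n.+1]addn1 iotaD map_cat. Qed.

Lemma size_enc_coeffs p n (q : {poly 'F_p}) : size (enc_coeffs n q) = n.
Proof. by rewrite size_map size_iota. Qed.

Lemma decide_correct (p : nat) (phi : {poly 'F_p}) (hphi : monic_irreducible_poly phi)
    (u v : GFq hphi) (k : nat) (a : 'I_k -> GFq hphi) (alpha beta : 'I_k -> nat) :
  prime p -> (forall j, alpha j + beta j < p)%N ->
  decide (enc_instance u v a alpha beta) = (sparse_shift_poly u v a alpha beta == 0).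
Proof.
move=> p_pr ltp; rewrite /decide /enc_instance parse_enc_nats; set s := (size phi).-1.
set fl := flatten _; rewrite enc_coeffsS -/s -!catA.
set rest := enc_coeffs s phi ++ _; pose L := map bits (p :: s :: rest).
rewrite -[decide_nats _]/(decide_data L (bits p) (unary L (bits s))
                            (map (fit (bits p)) (map bits rest))).
(* Used twice: [L] is long enough to clock the unary expansion of [s], and its squared length
   dominates [k^2 + k]. *)
have szL : (s + k + 2 <= size L)%N.
  rewrite /L /rest /= size_map !size_cat /= !size_cat !size_enc_coeffs /=.
  suff : (k <= size fl)%N by lia.
  rewrite /fl size_flatten /shape -map_comp sumnE big_map big_enum /=.
  apply: leq_trans (_ : \sum_(j < k) 1 <= _)%N; first by rewrite sum1_card card_ord.
  by apply: leq_sum => j _; rewrite size_cat /=; lia.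
set sl := unary L (bits s).
have ssl : size sl = s by rewrite size_unary bval_bits //; lia.
rewrite -map_comp -[map _ rest]/(map (enc_elt p) rest) /decide_data.
rewrite !takecE !dropcE ssl /rest !map_cat.
have szc q : size (map (enc_elt p) (enc_coeffs s q)) = s.
  by rewrite size_map size_enc_coeffs.
rewrite take_size_cat ?szc // drop_size_cat ?szc // [behead _]/=.
rewrite take_size_cat ?szc // drop_size_cat ?szc //.
rewrite take_size_cat ?szc // drop_size_cat ?szc // [behead _]/=.
have -> : map (enc_elt p) fl = flatten (map (enc_term a alpha beta) (enum 'I_k)).
  rewrite map_flatten; congr flatten; rewrite -map_comp.
  by apply: eq_map => j; rewrite /= map_cat.
rewrite /decide_fields chunksE; last 2 first.
- by [].
- by apply/allP => c /mapP[j _ ->]; rewrite size_cat /= !size_map size_iota ssl addn2.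
rewrite pad3E; set N := (_ + 2)%N.
have N_gt1 : (1 < N)%N by rewrite /N; lia.
have leN : (k * k + k <= N)%N by rewrite /N; nia.
clearbody N; move: sl ssl => sl ssl.
have imp2 := implements_GFq hphi p_pr.
have [v1 E1] := imp1 imp2; have [v2 E2] := impD imp2 v1 v1; rewrite E1 in E2.
have [vu Eu] := sem_enc_field p_pr u; have [vv Ev] := sem_enc_field p_pr v.
apply/andP/eqP => [[c1 c2]|P0].
  have d1 := check_dvdp p_pr ltp N_gt1 ssl v1 E1 vu Eu vv Ev c1.
  have d2 := check_dvdp p_pr ltp N_gt1 ssl v2 E2 vu Eu vv Ev c2.
  have charp : p \in [pchar GFq hphi].
    by rewrite (pchar_qpoly phi) pchar_Fp.
  exact: (sparse_shift_eq0 charp ltp leN N_gt1 d1 d2).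
split; first exact: (check_eq0 p_pr ltp N_gt1 ssl v1 E1 vu Eu vv Ev P0).
exact: (check_eq0 p_pr ltp N_gt1 ssl v2 E2 vu Eu vv Ev P0).
Qed.

Theorem theorem5p3 :
  exists (M : TM) (c : nat),
    forall (p : nat) (phi : {poly 'F_p}) (hphi : monic_irreducible_poly phi),
    prime p ->
    forall (u v : GFq hphi) (k : nat) (a : 'I_k -> GFq hphi)
           (alpha beta : 'I_k -> nat),
    (forall j : 'I_k, alpha j + beta j < p)%N ->
    let w := enc_instance u v a alpha beta in
    tm_decides_within M w (sparse_shift_poly u v a alpha beta == 0)
                      (c * (size w).+1 ^ c)%N.
Proof.
have [M [c H]] := ptime_decides ptime_decide.
exists M, c => p phi hphi p_pr u v k a alpha beta ltp w.
by rewrite -(decide_correct _ _ _ p_pr ltp); apply: H.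
Qed.
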